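(* Let $\mathcal{M}=hK_\theta$ be a nearly $S^*$-invariant subspace of $H^2$, where $h$ is its extremal function and $\theta$ is the associated inner function, with $\theta(0)=0$. Let $A_z^{\mathcal{M}}$ be the compressed shift on $\mathcal{M}$, and let $v=\langle\theta,|h|^2\rangle$. Then every $A_z^{\mathcal{M}}$-invariant (closed) subspace of $\mathcal{M}$ is of the form $hJ_v^{-1}(K_{\theta_v}\ominus K_\phi)$, where $\phi$ is an inner function dividing the Frostman shift $\theta_v$ of $\theta$, and $J_v^{-1}:K_{\theta_v}\to K_\theta$ is the inverse of the Crofoot transform.
   Context: $H^2=H^2(\mathbb{D})$ is the Hardy space of the unit disc, viewed also as a subspace of $L^2=L^2(\mathbb{T})$; $S$ is the shift $(Sf)(z)=zf(z)$ and $S^*$ is its adjoint. For an inner function $\theta$, $K_\theta=H^2\ominus\theta H^2$ is the model space. A closed subspace $\mathcal{M}\subseteq H^2$ is nearly $S^*$-invariant if $f\in\mathcal{M}$ and $f(0)=0$ imply $S^*f\in\mathcal{M}$. Saying that $\mathcal{M}=hK_\theta$ is nearly $S^*$-invariant with extremal function $h$ and associated inner function $\theta$, $\theta(0)=0$, means (Hitt's theorem): $h\in\mathcal{M}$, $\|h\|=1$, $h(0)>0$, $h$ is orthogonal to every element of $\mathcal{M}$ vanishing at $0$, and multiplication by $h$ is an isometry of $K_\theta$ onto $\mathcal{M}$. The compressed shift on $\mathcal{M}$ is $A_z^{\mathcal{M}}f=P_{\mathcal{M}}(zf)$, $f\in\mathcal{M}$, where $P_{\mathcal{M}}$ is the orthogonal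 projection of $L^2$ onto $\mathcal{M}$. Here $\langle\theta,|h|^2\rangle=\int_{\mathbb{T}}\theta|h|^2\,dm$ with $m$ normalized Lebesgue measure, and $|v|<1$. The Frostman shift of $\theta$ is the inner function $\theta_v=\dfrac{\theta-v}{1-\overline{v}\theta}$. The Crofoot transform is the unitary operator $J_v:K_\theta\to K_{\theta_v}$, $J_vf=\dfrac{\sqrt{1-|v|^2}}{1-\overline{v}\theta}f$, with inverse $J_v^{-1}g=\dfrac{\sqrt{1-|v|^2}}{1+\overline{v}\theta_v}g$. An inner function $\phi$ divides $\theta_v$ if $\theta_v/\phi$ is inner (unimodular constants are allowed as inner functions, with $K_\phi=\{0\}$ then). *)

(* Defs.v *)
From HB Require Import structures.
From mathcomp Require Import all_boot all_order all_algebra.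
From mathcomp Require Import complex ring.
From mathcomp Require Import all_classical all_reals all_analysis.

Set Implicit Arguments.
Unset Strict Implicit.
Unset Printing Implicit Defensive.

Import Order.TTheory GRing.Theory Num.Theory.
Import numFieldNormedType.Exports.
Import ComplexField.Normc.

Local Open Scope classical_set_scope.
Local Open Scope complex_scope.
Local Open Scope ring_scope.

(* The unit circle with normalized Lebesgue measure is parametrized by         *)
(* t |-> exp(2 i pi t), t in [0, 1] with Lebesgue measure. A function on the    *)
(* circle is an f : R -> R[i], of which only the values on [0, 1] matter, and   *)
(* elements of L^2 are identified when they agree almost everywhere.           *)

Section Circle.
Variable R : realType.
Local Notation mu := (@lebesgue_measure R).
Local Notation I01 := (`[0, 1]%classic : set R).

Definition zeta (t : R) : R[i] :=
  cos (2 * pi * t) +i* sin (2 * pi * t).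

Definition cint (f : R -> R[i]) : R[i] :=
  (\int[mu]_(t in I01) complex.Re (f t)) +i* (\int[mu]_(t in I01) complex.Im (f t)).

Definition aeq (f g : R -> R[i]) : Prop := ae_eq mu I01 f g.

Definition L2 : set (R -> R[i]) := [set f : R -> R[i] |
  [/\ measurable_fun I01 (fun t => complex.Re (f t)),
      measurable_fun I01 (fun t => complex.Im (f t)) &
      (\int[mu]_(t in I01) ((normc (f t) ^+ 2)%:E) < +oo)%E]].

Definition inner_prod (f g : R -> R[i]) : R[i] :=
  cint (fun t => f t * (g t)^*).

Definition norm2 (f : R -> R[i]) : R :=
  Num.sqrt (\int[mu]_(t in I01) (normc (f t) ^+ 2)).

(* Closure under almost everywhere equality is a consequence of the last field *)
(* (take u constant). *)
Record closed_subspace (N : set (R -> R[i])) : Prop := ClosedSubspace {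
  closed_subspace_L2 : N `<=` L2 ;
  closed_subspace0 : N (fun=> 0) ;
  closed_subspace_lin : forall (a : R[i]) f g,
    N f -> N g -> N (fun t => a * f t + g t) ;
  closed_subspace_lim : forall (u : nat -> R -> R[i]) f,
    (forall n, N (u n)) -> L2 f ->
    (fun n => norm2 (u n \- f)) @ \oo --> (0 : R) -> N f
}.

Definition ominus (A B : set (R -> R[i])) : set (R -> R[i]) :=
  [set f | A f /\ forall g, B g -> inner_prod f g = 0].

(* The subspace h A, as a set of elements of L^2 closed under a.e. equality.   *)
Definition mul_set (h : R -> R[i]) (A : set (R -> R[i])) : set (R -> R[i]) :=
  [set f | L2 f /\ exists2 g, A g & aeq f (h \* g)].

Definition orth_proj (N : set (R -> R[i])) (f : R -> R[i]) : R -> R[i] :=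
  xget (fun=> 0)
    [set g | N g /\ forall k, N k -> inner_prod (f \- g) k = 0].

Definition fourier_coef (f : R -> R[i]) (n : int) : R[i] :=
  inner_prod f (fun t => zeta t ^ n).

Definition H2 : set (R -> R[i]) := [set f : R -> R[i] |
  L2 f /\ forall n : nat, fourier_coef f (- n.+1%:Z) = 0].

(* The value at w, |w| < 1, of the holomorphic function on the disc with        *)
(* boundary function f in H^2 (Cauchy's formula).                              *)
Definition disc_val (f : R -> R[i]) (w : R[i]) : R[i] :=
  cint (fun t => f t / (1 - w * (zeta t)^*)).

Definition inner_function (theta : R -> R[i]) : Prop :=
  H2 theta /\ aeq (fun t => `|theta t|) (fun=> 1).

Definition inner_divides (phi theta : R -> R[i]) : Prop :=
  inner_function (fun t => theta t / phi t).

Definition model_space (theta : R -> R[i]) : set (R -> R[i]) :=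
  ominus H2 (mul_set theta H2).

Definition mul_zeta (f : R -> R[i]) : R -> R[i] := fun t => zeta t * f t.

(* S^*, the Hilbert space adjoint of the shift on H^2.                         *)
Definition shift_adjoint (f : R -> R[i]) : R -> R[i] :=
  xget (fun=> 0)
    [set g | H2 g /\
       forall k, H2 k -> inner_prod (mul_zeta k) f = inner_prod k g].

Definition nearly_invariant (M : set (R -> R[i])) : Prop :=
  [/\ closed_subspace M, M `<=` H2 &
      forall f, M f -> disc_val f 0 = 0 -> M (shift_adjoint f)].

Record hitt (M : set (R -> R[i])) (h theta : R -> R[i]) : Prop := Hitt {
  hitt_nearly_invariant : nearly_invariant M ;
  hitt_mem : M h ;
  hitt_norm : norm2 h = 1 ;
  hitt_gt0 : 0 < disc_val h 0 ;
  hitt_extremal : forall f, M f -> disc_val f 0 = 0 -> inner_prod h f = 0 ;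
  hitt_inner : inner_function theta ;
  hitt_theta0 : disc_val theta 0 = 0 ;
  hitt_isometry : forall k, model_space theta k ->
    M (h \* k) /\ norm2 (h \* k) = norm2 k ;
  hitt_onto : M = mul_set h (model_space theta)
}.

Definition compressed_shift (M : set (R -> R[i])) (f : R -> R[i]) :
  R -> R[i] := orth_proj M (mul_zeta f).

Definition frostman (v : R[i]) (theta : R -> R[i]) : R -> R[i] :=
  fun t => (theta t - v) / (1 - v^* * theta t).

Definition crofoot (v : R[i]) (theta f : R -> R[i]) : R -> R[i] :=
  fun t => (Num.sqrt (1 - normc v ^+ 2))%:C / (1 - v^* * theta t) * f t.

Definition crofoot_inv (v : R[i]) (theta g : R -> R[i]) : R -> R[i] :=
  fun t => (Num.sqrt (1 - normc v ^+ 2))%:C /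
           (1 + v^* * frostman v theta t) * g t.

(* On the circle |theta| = 1 a.e., so the denominator is nonzero when |v| < 1. *)
Lemma crofootK (v : R[i]) (theta f : R -> R[i]) (t : R) :
  normc v < 1 -> 1 - v^* * theta t != 0 ->
  crofoot_inv v theta (crofoot v theta f) t = f t.
Proof.
move=> v1 d0; rewrite /crofoot_inv /crofoot /frostman.
have v2 : 0 < 1 - normc v ^+ 2.
  by rewrite subr_gt0 expr_lt1// /normc; case: (v) => a b; exact: sqrtr_ge0.
set s := (Num.sqrt _)%:C.
have sE : s ^+ 2 = 1 - v^* * v.
  rewrite /s -rmorphXn/= sqr_sqrtr ?ltW// rmorphB/= rmorph1 rmorphXn/=.
  by congr (_ - _); rewrite mulrC; exact: sqr_normc.
have s0 : s != 0.
  by rewrite /s -(rmorph0 (real_complex R)) (inj_eq (@complexI _)) gt_eqF ?sqrtr_gt0.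
have -> : 1 + v^* * ((theta t - v) / (1 - v^* * theta t)) =
    s ^+ 2 / (1 - v^* * theta t).
  rewrite sE; apply: (mulIf d0).
  by rewrite mulrDl mul1r -mulrA !divfK// mulrBr addrA subrK.
by field; rewrite s0 d0.
Qed.

End Circle.

(* Main.v *)
(* With [c = <zeta f, theta>] one has [A_z^M (h f) = h (zeta f - c theta + c v)] for [f] in
   [K_theta]: the term [c theta], which leaves [K_theta], is projected using
   [<h theta, h g> = v <1, g>] for [g] in [K_theta]. Since
   [theta - v = (1 - v^* theta) theta_v] and [(1 - v^* theta) K_{theta_v} = K_theta], the
   operator is carried by [g |-> h (1 - v^* theta) g] to the compressed shift of
   [K_{theta_v}]. If [N'] is invariant there, then [N' + theta_v H2] is closed and invariant
   under the shift, hence equals [phi H2] by Beurling's theorem, and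
   [N' = K_{theta_v} (-) K_phi].
   Beurling's theorem rests on orthogonal projections (completeness of [L2], by a fast Cauchy
   sequence and Fatou's lemma) and on the uniqueness of Fourier coefficients in [L1]. *)
Require Import Defs.
From mathcomp Require Import all_boot all_order all_algebra.
From mathcomp Require Import complex ring lra.
From mathcomp Require Import all_classical all_reals all_analysis measurable_realfun.

Set Implicit Arguments.
Unset Strict Implicit.
Unset Printing Implicit Defensive.

Import Order.TTheory GRing.Theory Num.Theory.
Import numFieldNormedType.Exports.
Import ComplexField.Normc.

Local Open Scope classical_set_scope.
Local Open Scope complex_scope.
Local Open Scope ring_scope.

(** * Integrals of complex functions *)

Section ComplexIntegral.
Variable R : realType.
Local Notation mu := (@lebesgue_measure R).
Local Notation I01 := (`[0, 1]%classic : set R).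
Local Notation Re := complex.Re.
Local Notation Im := complex.Im.
Implicit Types (f g : R -> R[i]) (a z : R[i]).

(** The correction [c v] turns the subtracted [theta] into [theta - v], whose inner factor is the
    Frostman shift once [1 / (1 - v^* theta)] is known to be a bounded element of H2. This needs
    [|v| < 1], which has to be derived, from [h(0) > 0]. [h] may be unbounded and is controlled only
    through the isometry on [K_theta], to which [theta] does not belong. Products with [h] are
    therefore brought back to elements of [K_theta]; for [h theta] this is done by the conjugation
    [f |-> conj(zeta) theta conj(f)]. H2 is given by boundary values alone, so facts usually read
    off from holomorphy in the disc, such as the membership of a product or of
    [1 / (1 - v^* theta)], are obtained by orthogonality arguments. Division by [1 - v^* theta] is
    justified where [|theta| = 1], so the identities hold almost everywhere, and closed subspaces
    absorb the exceptional null sets. *)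

Lemma ReD z1 z2 : Re (z1 + z2 : R[i]) = Re z1 + Re z2.
Proof. by case: z1 z2 => [? ?] [? ?]. Qed.
Lemma ImD z1 z2 : Im (z1 + z2 : R[i]) = Im z1 + Im z2.
Proof. by case: z1 z2 => [? ?] [? ?]. Qed.
Lemma ReM z1 z2 : Re (z1 * z2 : R[i]) = Re z1 * Re z2 - Im z1 * Im z2.
Proof. by case: z1 z2 => [? ?] [? ?]. Qed.
Lemma ImM z1 z2 : Im (z1 * z2 : R[i]) = Re z1 * Im z2 + Im z1 * Re z2.
Proof. by case: z1 z2 => [? ?] [? ?]. Qed.
Lemma ReJ z : Re z^* = Re z. Proof. by case: z. Qed.
Lemma ImJ z : Im z^* = - Im z. Proof. by case: z. Qed.

Lemma complexP z1 z2 : Re z1 = Re z2 -> Im z1 = Im z2 -> z1 = z2 :> R[i].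
Proof. by case: z1 z2 => [? ?] [? ?] /= -> ->. Qed.

Lemma conjcD z1 z2 : (z1 + z2 : R[i])^* = z1^* + z2^*.
Proof. exact: rmorphD. Qed.
Lemma conjcM z1 z2 : (z1 * z2 : R[i])^* = z1^* * z2^*.
Proof. exact: rmorphM. Qed.
Lemma conjcN z : (- z : R[i])^* = - z^*.
Proof. exact: rmorphN. Qed.

Lemma conjcKE z : z^*^* = z. Proof. exact: conjcK. Qed.
Lemma conjc0E : (0 : R[i])^* = 0. Proof. exact: conjc0. Qed.
Lemma conjc1E : (1 : R[i])^* = 1. Proof. exact: conjc1. Qed.

Lemma normc_ge0 z : 0 <= normc z.
Proof. by case: z => a b; exact: sqrtr_ge0. Qed.

Lemma normc_sqr z : normc z ^+ 2 = Re z ^+ 2 + Im z ^+ 2.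
Proof. by case: z => a b /=; rewrite sqr_sqrtr// addr_ge0// sqr_ge0. Qed.

Lemma mulcJE z : z * z^* = (normc z ^+ 2)%:C.
Proof. by apply: complexP; rewrite normc_sqr ?(ReM, ImM, ReJ, ImJ)/=; ring. Qed.

Lemma normcJE z : normc z^* = normc z.
Proof. by case: z => a b /=; rewrite sqrrN. Qed.

Lemma Re_le_normc z : `|Re z| <= normc z.
Proof.
rewrite -(@ler_pXn2r _ 2%N)// ?nnegrE ?normc_ge0// normc_sqr real_normK ?num_real//.
by rewrite lerDl sqr_ge0.
Qed.

Lemma Im_le_normc z : `|Im z| <= normc z.
Proof.
rewrite -(@ler_pXn2r _ 2%N)// ?nnegrE ?normc_ge0// normc_sqr real_normK ?num_real//.
by rewrite lerDr sqr_ge0.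
Qed.

Definition cmeas f := measurable_fun I01 (fun t => Re (f t)) /\
  measurable_fun I01 (fun t => Im (f t)).

Definition cintegrable f := mu.-integrable I01 (fun t => (Re (f t))%:E) /\
  mu.-integrable I01 (fun t => (Im (f t))%:E).

Lemma mI01 : (R.-ocitv.-measurable).-sigma.-measurable I01.
Proof. exact: measurable_itv. Qed.

Lemma mu_I01 : mu I01 = 1%E.
Proof. by rewrite lebesgue_measure_itv/= lte01 oppr0 adde0. Qed.

Lemma measurable_ext (u w : R -> R) : u =1 w -> measurable_fun I01 w ->
  measurable_fun I01 u.
Proof. by move=> /funext ->. Qed.

Lemma integrable_ext (u w : R -> \bar R) : u =1 w -> mu.-integrable I01 w ->
  mu.-integrable I01 u.
Proof. by move=> /funext ->. Qed.

Lemma cmeas_cst z : cmeas (fun=> z).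
Proof. by split; exact: measurable_cst. Qed.

Lemma cmeasD f g : cmeas f -> cmeas g -> cmeas (fun t => f t + g t).
Proof.
move=> [f1 f2] [g1 g2]; split.
  by apply: measurable_ext (measurable_funD f1 g1) => t; exact: ReD.
by apply: measurable_ext (measurable_funD f2 g2) => t; exact: ImD.
Qed.

Lemma cmeasM f g : cmeas f -> cmeas g -> cmeas (fun t => f t * g t).
Proof.
move=> [f1 f2] [g1 g2]; split.
  have := measurable_funB (measurable_funM f1 g1) (measurable_funM f2 g2).
  by apply: measurable_ext => t; exact: ReM.
have := measurable_funD (measurable_funM f1 g2) (measurable_funM f2 g1).
by apply: measurable_ext => t; exact: ImM.
Qed.

Lemma cmeasN f : cmeas f -> cmeas (fun t => - f t).
Proof.
move=> mf; have := cmeasM (cmeas_cst (-1)) mf.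
by congr cmeas; apply/funext => t; rewrite mulN1r.
Qed.

Lemma cmeasB f g : cmeas f -> cmeas g -> cmeas (fun t => f t - g t).
Proof. by move=> mf mg; apply: cmeasD => //; exact: cmeasN. Qed.

Lemma cmeasJ f : cmeas f -> cmeas (fun t => (f t)^*).
Proof.
move=> [f1 f2]; split; first by apply: measurable_ext f1 => t; exact: ReJ.
by apply: measurable_ext (measurable_funN f2) => t; exact: ImJ.
Qed.

Lemma measurable_normc2 f : cmeas f -> measurable_fun I01 (fun t => normc (f t) ^+ 2).
Proof.
move=> [f1 f2]; apply: (@measurable_ext _ (fun t => Re (f t) ^+ 2 + Im (f t) ^+ 2)).
  by move=> t; exact: normc_sqr.
by apply: measurable_funD; exact: measurable_funX.
Qed.

(** [1 / f = conj f / |f|^2], also at the zeros of [f] because [0^-1 = 0]; the real inverse is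
    measurable as a power with exponent -1. *)
Lemma cmeasV f : cmeas f -> cmeas (fun t => (f t)^-1).
Proof.
move=> mf; have mfi : measurable_fun I01 (fun t => (normc (f t) ^+ 2)^-1).
  apply: (@measurable_ext _ (fun t => powR (normc (f t) ^+ 2) (-1))).
    by move=> t; rewrite powR_inv1// exprn_ge0// normc_ge0.
  by have := measurableT_comp (measurable_powR (-1)) (measurable_normc2 mf).
have -> : (fun t => (f t)^-1) =
    (fun t => ((normc (f t) ^+ 2)^-1)%:C * (f t)^*).
  apply/funext => t; have [->|f0] := eqVneq (f t) 0.
    by apply: complexP; rewrite invr0 (ReM, ImM) /= oppr0 !mulr0 ?subr0 ?addr0.
  apply: (mulfI f0); rewrite divff// mulrCA mulcJE -rmorphM/= mulVf//.
  by rewrite expf_eq0/=; apply: contra f0 => /eqP/eq0_normc ->.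
by apply: cmeasM (cmeasJ mf); split => //; exact: measurable_cst.
Qed.

Lemma cintegrable_cmeas f : cintegrable f -> cmeas f.
Proof.
by move=> [/measurable_int/measurable_EFinP ? /measurable_int/measurable_EFinP ?].
Qed.

Lemma cintegrable_dom f (G : R -> R) : cmeas f -> mu.-integrable I01 (EFin \o G) ->
  (forall t, I01 t -> normc (f t) <= G t) -> cintegrable f.
Proof.
move=> [f1 f2] iG fG; split; apply: le_integrable iG => //.
- exact/measurable_EFinP.
- move=> t It /=; rewrite lee_fin (le_trans (Re_le_normc _))//.
  by rewrite (le_trans (fG _ It)) // ler_norm.
- exact/measurable_EFinP.
- move=> t It /=; rewrite lee_fin (le_trans (Im_le_normc _))//.
  by rewrite (le_trans (fG _ It)) // ler_norm.
Qed.

Lemma cintegrableD f g : cintegrable f -> cintegrable g ->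
  cintegrable (fun t => f t + g t).
Proof.
move=> [f1 f2] [g1 g2]; split.
  by apply: integrable_ext (integrableD mI01 f1 g1) => t; rewrite ReD.
by apply: integrable_ext (integrableD mI01 f2 g2) => t; rewrite ImD.
Qed.

Lemma cintegrableZ a f : cintegrable f -> cintegrable (fun t => a * f t).
Proof.
move=> [f1 f2]; split.
  have := integrableB mI01 (integrableZl mI01 (Re a) f1) (integrableZl mI01 (Im a) f2).
  by apply: integrable_ext => t; rewrite ReM.
have := integrableD mI01 (integrableZl mI01 (Re a) f2) (integrableZl mI01 (Im a) f1).
by apply: integrable_ext => t; rewrite ImM.
Qed.

Lemma cintD f g : cintegrable f -> cintegrable g ->
  cint (fun t => f t + g t) = cint f + cint g.
Proof.
move=> [f1 f2] [g1 g2]; apply: complexP; rewrite (ReD, ImD)/=.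
  by under eq_Rintegral do rewrite ReD; rewrite RintegralD//; exact: mI01.
by under eq_Rintegral do rewrite ImD; rewrite RintegralD//; exact: mI01.
Qed.

Lemma cintZ a f : cintegrable f -> cint (fun t => a * f t) = a * cint f.
Proof.
have H r (u : R -> R) : mu.-integrable I01 (EFin \o u) ->
    mu.-integrable I01 (EFin \o (fun x => r * u x)).
  by move=> iu; have := integrableZl mI01 r iu.
move=> [f1 f2]; apply: complexP; rewrite (ReM, ImM)/=.
  under eq_Rintegral do rewrite ReM.
  by rewrite RintegralB ?RintegralZl//; [exact: mI01..|exact: H|exact: H].
under eq_Rintegral do rewrite ImM.
by rewrite RintegralD ?RintegralZl//; [exact: mI01..|exact: H|exact: H].
Qed.

Lemma cintJ f : cintegrable f -> cint (fun t => (f t)^*) = (cint f)^*.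
Proof.
move=> [f1 f2]; apply: complexP; rewrite (ReJ, ImJ)/=.
  by under eq_Rintegral do rewrite ReJ.
under eq_Rintegral do rewrite ImJ -mulN1r.
by rewrite RintegralZl// ?mulN1r//; exact: mI01.
Qed.

Lemma cint_cst z : cint (fun=> z) = z.
Proof.
have H : fine (mu I01) = 1 by rewrite mu_I01.
by apply: complexP => /=; rewrite Rintegral_cst ?H ?mulr1//; exact: mI01.
Qed.

Lemma cintegrable_cst z : cintegrable (fun=> z).
Proof.
have fin : (mu I01 < +oo)%E by rewrite mu_I01 ltry.
have H r : mu.-integrable I01 (EFin \o (fun=> r)).
  apply: measurable_bounded_integrable => //.
  by exists `|r|; split; rewrite ?num_real// => x rx t _; exact: ltW.
by split; exact: H.
Qed.

Lemma aeq_refl f : aeq f f. Proof. exact: ae_eq_refl. Qed.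
Lemma aeq_sym f g : aeq f g -> aeq g f. Proof. exact: ae_eq_sym. Qed.

Lemma cint_aeq f g : cmeas f -> cmeas g -> aeq f g -> cint f = cint g.
Proof.
move=> [f1 f2] [g1 g2] fg; congr Complex; congr fine; apply: ae_eq_integral.
- exact: mI01.
- exact/measurable_EFinP.
- exact/measurable_EFinP.
- exact: (@ae_eq_comp _ _ _ mu I01 _ _ (fun z => (Re z)%:E)).
- exact: mI01.
- exact/measurable_EFinP.
- exact/measurable_EFinP.
- exact: (@ae_eq_comp _ _ _ mu I01 _ _ (fun z => (Im z)%:E)).
Qed.

End ComplexIntegral.

Arguments mI01 {R}.

(** * The space L2 of the circle *)

Section L2Space.
Variable R : realType.
Local Notation mu := (@lebesgue_measure R).
Local Notation I01 := (`[0, 1]%classic : set R).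
Local Notation Re := complex.Re.
Local Notation Im := complex.Im.
Implicit Types (f g k : R -> R[i]) (a z : R[i]).

Lemma ae_imp (P Q : R -> Prop) : (forall t, P t -> Q t) ->
  {ae mu, forall t, P t} -> {ae mu, forall t, Q t}.
Proof. by move=> PQ; apply: (@filterS _ _ (ae_filter_ringOfSetsType mu)). Qed.

Lemma ae_imp2 (P1 P2 Q : R -> Prop) : (forall t, P1 t -> P2 t -> Q t) ->
  {ae mu, forall t, P1 t} -> {ae mu, forall t, P2 t} -> {ae mu, forall t, Q t}.
Proof. by move=> PQ; apply: (@filterS2 _ _ (ae_filter_ringOfSetsType mu)). Qed.

Lemma L2_cmeas f : L2 f -> cmeas f. Proof. by case=> ? ? _; split. Qed.

Lemma L2_integrable f : L2 f -> mu.-integrable I01 (EFin \o (fun t => normc (f t) ^+ 2)).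
Proof.
move=> Lf; have [_ _ fin] := Lf; apply/integrableP; split.
  by apply/measurable_EFinP; apply: measurable_normc2; exact: L2_cmeas.
by under eq_integral do rewrite /= ger0_norm ?sqr_ge0//.
Qed.

Lemma L2I f : cmeas f -> mu.-integrable I01 (EFin \o (fun t => normc (f t) ^+ 2)) -> L2 f.
Proof.
move=> [? ?] /integrableP[_ fin]; split => //; move: fin.
by under eq_integral do rewrite /= ger0_norm ?sqr_ge0//.
Qed.

Lemma L2_dom f (G : R -> R) : cmeas f -> mu.-integrable I01 (EFin \o G) ->
  {ae mu, forall t, I01 t -> normc (f t) ^+ 2 <= G t} -> L2 f.
Proof.
move=> mf iG fG; have /integrableP[mG] := iG.
move=> fin; have [m1 m2] := mf; split => //; apply: le_lt_trans fin.
apply: ae_ge0_le_integral; first exact: mI01.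
- by move=> t _; rewrite lee_fin sqr_ge0.
- by apply/measurable_EFinP; exact: measurable_normc2.
- by [].
- exact: measurableT_comp.
- move: fG; apply: ae_imp => t fG It; rewrite /= lee_fin.
  by rewrite (le_trans (fG It)) ?ler_norm.
Qed.

Lemma normcD_sqr z1 z2 : normc (z1 + z2 : R[i]) ^+ 2 <= 2 * normc z1 ^+ 2 + 2 * normc z2 ^+ 2.
Proof.
rewrite !normc_sqr ReD ImD -subr_ge0.
rewrite (_ : _ - _ = (Re z1 - Re z2) ^+ 2 + (Im z1 - Im z2) ^+ 2); last by ring.
by rewrite addr_ge0// sqr_ge0.
Qed.

Lemma integrableZ (r : R) (u : R -> R) : mu.-integrable I01 (EFin \o u) ->
  mu.-integrable I01 (EFin \o (fun t => r * u t)).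
Proof. by move=> iu; have := integrableZl mI01 r iu. Qed.

Lemma integrable_add (u w : R -> R) : mu.-integrable I01 (EFin \o u) ->
  mu.-integrable I01 (EFin \o w) -> mu.-integrable I01 (EFin \o (fun t => u t + w t)).
Proof. by move=> iu iw; have := integrableD mI01 iu iw. Qed.

Lemma L2D f g : L2 f -> L2 g -> L2 (fun t => f t + g t).
Proof.
move=> Lf Lg; apply: (@L2_dom _ (fun t => 2 * normc (f t) ^+ 2 + 2 * normc (g t) ^+ 2)).
- by apply: cmeasD; exact: L2_cmeas.
- by apply: integrable_add; apply: integrableZ; exact: L2_integrable.
- by apply/aeW => t _; exact: normcD_sqr.
Qed.

Lemma L2M_bdd (C : R) f g : cmeas f -> {ae mu, forall t, I01 t -> normc (f t) <= C} ->
  L2 g -> L2 (fun t => f t * g t).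
Proof.
move=> mf fC Lg; apply: (@L2_dom _ (fun t => C ^+ 2 * normc (g t) ^+ 2)).
- by apply: cmeasM => //; exact: L2_cmeas.
- by apply: integrableZ; exact: L2_integrable.
- move: fC; apply: ae_imp => t fC It; rewrite normcM exprMn.
  by rewrite ler_wpM2r ?sqr_ge0// lerXn2r ?nnegrE ?normc_ge0 ?(le_trans _ (fC It))// normc_ge0.
Qed.

Lemma L2Z a f : L2 f -> L2 (fun t => a * f t).
Proof.
by apply: (@L2M_bdd (normc a)); [exact: cmeas_cst|exact: aeW].
Qed.

Lemma L2N f : L2 f -> L2 (fun t => - f t).
Proof. by move=> /(L2Z (-1)); congr L2; apply/funext => t; rewrite mulN1r. Qed.

Lemma L2B f g : L2 f -> L2 g -> L2 (fun t => f t - g t).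
Proof. by move=> Lf Lg; apply: L2D => //; exact: L2N. Qed.

Lemma L2J f : L2 f -> L2 (fun t => (f t)^*).
Proof.
move=> Lf; apply: L2_dom (L2_integrable Lf) _; first exact/cmeasJ/L2_cmeas.
by apply/aeW => t _; rewrite normcJE.
Qed.

Lemma L2_cst z : L2 (fun=> z).
Proof.
apply: L2I; first exact: cmeas_cst.
have [+ _] := cintegrable_cst ((normc z ^+ 2)%:C); exact.
Qed.

Lemma L2_aeq f g : cmeas g -> aeq f g -> L2 f -> L2 g.
Proof.
move=> mg fg Lf; apply: L2_dom (L2_integrable Lf) _ => //.
by move: fg; apply: ae_imp => t fg It; rewrite fg.
Qed.

Lemma ip_cintegrable f g : L2 f -> L2 g -> cintegrable (fun t => f t * (g t)^*).
Proof.
move=> Lf Lg; apply: cintegrable_dom (integrable_add (L2_integrable Lf) (L2_integrable Lg)) _.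
  by apply: cmeasM; [exact: L2_cmeas|exact/cmeasJ/L2_cmeas].
move=> t _; rewrite normcM normcJE.
have := normc_ge0 (f t); have := normc_ge0 (g t); nra.
Qed.

Lemma ipDl f g k : L2 f -> L2 g -> L2 k ->
  inner_prod (fun t => f t + g t) k = inner_prod f k + inner_prod g k.
Proof.
move=> Lf Lg Lk; rewrite -cintD; [|exact: ip_cintegrable..].
by congr cint; apply/funext => t; rewrite mulrDl.
Qed.

Lemma ipZl a f k : L2 f -> L2 k ->
  inner_prod (fun t => a * f t) k = a * inner_prod f k.
Proof.
move=> Lf Lk; rewrite -cintZ; [|exact: ip_cintegrable..].
by congr cint; apply/funext => t; rewrite mulrA.
Qed.

Lemma ipC f g : L2 f -> L2 g -> inner_prod g f = (inner_prod f g)^*.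
Proof.
move=> Lf Lg; rewrite -cintJ; [|exact: ip_cintegrable..].
by congr cint; apply/funext => t; rewrite conjcM conjcKE mulrC.
Qed.

Lemma ipNl f k : L2 f -> L2 k -> inner_prod (fun t => - f t) k = - inner_prod f k.
Proof.
move=> Lf Lk; rewrite -mulN1r -(ipZl (-1) Lf Lk); congr inner_prod.
by apply/funext => t; rewrite mulN1r.
Qed.

Lemma ipBl f g k : L2 f -> L2 g -> L2 k ->
  inner_prod (fun t => f t - g t) k = inner_prod f k - inner_prod g k.
Proof. by move=> Lf Lg Lk; rewrite ipDl ?ipNl//; exact: L2N. Qed.

Lemma ipDr f g k : L2 f -> L2 g -> L2 k ->
  inner_prod k (fun t => f t + g t) = inner_prod k f + inner_prod k g.
Proof.
move=> Lf Lg Lk; rewrite (@ipC (fun t => f t + g t)) ?ipDl//; last exact: L2D.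
by rewrite conjcD -!ipC.
Qed.

Lemma ipZr a f k : L2 f -> L2 k ->
  inner_prod k (fun t => a * f t) = a^* * inner_prod k f.
Proof.
move=> Lf Lk; rewrite (@ipC (fun t => a * f t)) ?ipZl//; last exact: L2Z.
by rewrite conjcM -!ipC.
Qed.

Lemma ipBr f g k : L2 f -> L2 g -> L2 k ->
  inner_prod k (fun t => f t - g t) = inner_prod k f - inner_prod k g.
Proof.
move=> Lf Lg Lk; rewrite (@ipC (fun t => f t - g t)) ?ipBl//; last exact: L2B.
by rewrite conjcD conjcN -!ipC.
Qed.

Lemma ip_aeql f g k : L2 f -> L2 g -> L2 k -> aeq f g ->
  inner_prod f k = inner_prod g k.
Proof.
move=> Lf Lg Lk fg; apply: cint_aeq.
- by apply: cintegrable_cmeas; exact: ip_cintegrable.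
- by apply: cintegrable_cmeas; exact: ip_cintegrable.
- by move: fg; apply: ae_imp => t fg It; rewrite fg.
Qed.

Lemma ip_aeqr f g k : L2 f -> L2 g -> L2 k -> aeq f g ->
  inner_prod k f = inner_prod k g.
Proof.
by move=> Lf Lg Lk fg; rewrite (ipC Lf Lk) (ip_aeql Lf Lg Lk fg) -ipC.
Qed.

Lemma norm2_ge0 f : 0 <= norm2 f. Proof. exact: sqrtr_ge0. Qed.

Lemma ip_norm2 f : inner_prod f f = (norm2 f ^+ 2)%:C.
Proof.
rewrite /norm2 sqr_sqrtr; last by apply: Rintegral_ge0 => t _; exact: sqr_ge0.
apply: complexP; rewrite /inner_prod /cint/=.
  by apply: eq_Rintegral => t _; rewrite mulcJE.
under eq_Rintegral do rewrite mulcJE/=.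
by rewrite Rintegral_cst ?mul0r//; exact: mI01.
Qed.

Lemma norm2_eq0 f : L2 f -> norm2 f = 0 -> aeq f (fun=> 0).
Proof.
move=> Lf f0; have mf := measurable_normc2 (L2_cmeas Lf).
have : (\int[mu]_(t in I01) `|(normc (f t) ^+ 2)%:E| = 0)%E.
  under eq_integral do rewrite /= ger0_norm ?sqr_ge0//.
  have /eqP := f0; rewrite /norm2 -[X in _ == X]sqrtr0 eqr_sqrt// ?Rintegral_ge0//; last first.
    by move=> t _; exact: sqr_ge0.
  move=> /eqP e0; rewrite -(fineK (integrable_fin_num mI01 (L2_integrable Lf))).
  by congr EFin.
move/ae_eq_integral_abs => H.
have {H} := H mI01 ltac:(exact/measurable_EFinP).
apply: ae_imp => t H It; apply: eq0_normc; apply/eqP.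
by rewrite -sqrf_eq0; apply/eqP; have [] := H It.
Qed.

Lemma norm2_aeq f g : L2 f -> L2 g ->
  {ae mu, forall t, I01 t -> normc (f t) = normc (g t)} -> norm2 f = norm2 g.
Proof.
move=> Lf Lg fg; congr Num.sqrt; congr fine; apply: ae_eq_integral.
- exact: mI01.
- by apply/measurable_EFinP; apply: measurable_normc2; exact: L2_cmeas.
- by apply/measurable_EFinP; apply: measurable_normc2; exact: L2_cmeas.
- by move: fg; apply: ae_imp => t fg It; rewrite fg.
Qed.

Lemma norm2_le (C : R) f g : 0 <= C -> L2 f -> L2 g ->
  {ae mu, forall t, I01 t -> normc (f t) <= C * normc (g t)} ->
  norm2 f <= C * norm2 g.
Proof.
move=> C0 Lf Lg fg.
rewrite -(@ler_pXn2r _ 2%N)// ?nnegrE ?mulr_ge0 ?norm2_ge0// exprMn.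
have I0 (u : R -> R[i]) : 0 <= \int[mu]_(t in I01) (normc (u t) ^+ 2).
  by apply: Rintegral_ge0 => t _; exact: sqr_ge0.
rewrite /norm2 !sqr_sqrtr// -RintegralZl//; last exact: L2_integrable.
have ig : mu.-integrable I01 (EFin \o (fun t => C ^+ 2 * normc (g t) ^+ 2)).
  exact/integrableZ/L2_integrable.
apply: fine_le.
- exact: integrable_fin_num (L2_integrable Lf).
- exact: integrable_fin_num ig.
- apply: ae_ge0_le_integral; first exact: mI01.
  + by move=> t _; rewrite lee_fin sqr_ge0.
  + by have /measurable_int := L2_integrable Lf.
  + by move=> t _; rewrite lee_fin mulr_ge0// sqr_ge0.
  + by have /measurable_int := ig.
  + move: fg; apply: ae_imp => t fg It; rewrite lee_fin -exprMn.
    by rewrite lerXn2r ?nnegrE ?normc_ge0 ?mulr_ge0// ?normc_ge0// fg.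
Qed.

Lemma norm2_sqr f : norm2 f ^+ 2 = Re (inner_prod f f).
Proof. by rewrite ip_norm2. Qed.

Lemma norm2_sub_sqr f g : L2 f -> L2 g ->
  norm2 (fun t => f t - g t) ^+ 2 =
    norm2 f ^+ 2 + norm2 g ^+ 2 - 2 * Re (inner_prod f g).
Proof.
move=> Lf Lg; rewrite !norm2_sqr ipBl ?ipBr//; last exact: L2B.
rewrite (ipC Lf Lg) !(ReD, ReJ).
have N z : Re (- z) = - Re z by case: z.
by rewrite !(N, ReD) ReJ; ring.
Qed.

Lemma norm2Z a f : L2 f -> norm2 (fun t => a * f t) ^+ 2 = normc a ^+ 2 * norm2 f ^+ 2.
Proof.
move=> Lf; rewrite !norm2_sqr ipZl ?ipZr//; last exact: L2Z.
by rewrite mulrA mulcJE ReM/= mul0r subr0.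
Qed.

Lemma cauchy_schwarz f g : L2 f -> L2 g ->
  normc (inner_prod f g) <= norm2 f * norm2 g.
Proof.
move=> Lf Lg; have [g0|g0] := eqVneq (norm2 g) 0.
  have L0 := L2_cst (0 : R[i]).
  rewrite (ip_aeqr Lg L0 Lf (norm2_eq0 Lg g0)) g0 mulr0.
  rewrite (_ : inner_prod _ _ = 0) ?normc0//.
  rewrite -[RHS](cint_cst 0); congr cint; apply/funext => t.
  by rewrite conjc0E mulr0.
have gp : 0 < norm2 g ^+ 2 by rewrite exprn_gt0// lt_def g0 norm2_ge0.
rewrite -(@ler_pXn2r _ 2%N)// ?nnegrE ?normc_ge0 ?mulr_ge0 ?norm2_ge0// exprMn.
set c := inner_prod f g.
(* The residual of projecting [f] on [g], scaled by [norm2 g ^+ 2] to avoid a division. *)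
have : 0 <= norm2 (fun t => (norm2 g ^+ 2)%:C * f t - c * g t) ^+ 2 by exact: sqr_ge0.
have Lbf := L2Z (norm2 g ^+ 2)%:C Lf; have Lcg := L2Z c Lg.
rewrite (norm2_sub_sqr Lbf Lcg) (norm2Z _ Lf) (norm2Z _ Lg) (ipZl _ Lf Lcg) (ipZr _ Lg Lf).
rewrite -/c [c^* * c]mulrC mulcJE -rmorphM/= expr0n/= addr0 sqrtr_sqr.
rewrite (ger0_norm (sqr_ge0 _)) => H.
rewrite -(ler_pM2l gp); lra.
Qed.

Lemma aeq_ip0 f : L2 f -> inner_prod f f = 0 -> aeq f (fun=> 0).
Proof.
move=> Lf; rewrite ip_norm2 => /(congr1 (@complex.Re R))/= /eqP; rewrite sqrf_eq0 => /eqP.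
exact: norm2_eq0.
Qed.

Lemma ip0l f : inner_prod (fun=> 0) f = 0.
Proof. by rewrite -[RHS](cint_cst 0); congr cint; apply/funext => t; rewrite mul0r. Qed.

Lemma norm20 : norm2 (fun=> 0 : R[i]) = 0.
Proof. by apply/eqP; rewrite -sqrf_eq0 norm2_sqr ip0l. Qed.

Definition orthogonal_of (X : set (R -> R[i])) : set (R -> R[i]) :=
  [set f | L2 f /\ forall k, X k -> inner_prod f k = 0].

(** For a limit [f] of members [u n], [|<f, k>| = |<u n - f, k>|] is at most
    [norm2 (u n - f) * norm2 k], which tends to 0. *)
Lemma closed_orthogonal_of (X : set (R -> R[i])) : X `<=` @L2 R ->
  closed_subspace (orthogonal_of X).
Proof.
move=> XL; split.
- by move=> f [].
- by split=> [|k _]; [exact: L2_cst|exact: ip0l].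
- move=> a f g [Lf f0] [Lg g0]; split; first by apply: L2D => //; exact: L2Z.
  move=> k Xk; have Lk := XL _ Xk.
  by rewrite ipDl ?ipZl ?f0 ?g0 ?mulr0 ?addr0//; exact: L2Z.
- move=> u f Xu Lf uf; split => // k Xk; have Lk := XL _ Xk.
  apply: eq0_normc.
  have H n : normc (inner_prod f k) <= norm2 (u n \- f) * norm2 k.
    have [Lu u0] := Xu n.
    rewrite -[inner_prod f k]subr0 -(u0 k Xk) -normcN opprB -ipBl//.
    by apply: cauchy_schwarz => //; exact: L2B.
  apply/eqP; rewrite eq_le normc_ge0 andbT.
  have cv : (fun n => norm2 (u n \- f) * norm2 k) @ \oo --> (0 : R).
    by rewrite -(mul0r (norm2 k)); apply: cvgM => //; exact: cvg_cst.
  rewrite -(cvg_lim _ cv)//; apply: limr_ge; first by apply/cvg_ex; eexists; exact: cv.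
  by apply: nearW => n; exact: H.
Qed.

End L2Space.

(** * Completeness and orthogonal projections *)

Section Completeness.
Variable R : realType.
Local Notation mu := (@lebesgue_measure R).
Local Notation I01 := (`[0, 1]%classic : set R).
Local Notation Re := complex.Re.
Local Notation Im := complex.Im.
Implicit Types (f g k : R -> R[i]) (a z : R[i]).

Lemma cvg_of_summable_increments (r w : nat -> R) :
  (forall n, `|r n.+1 - r n| <= w n) -> cvgn (series w) -> cvgn r.
Proof.
move=> rw cw.
have cd : cvgn (series (telescope r)).
  apply: normed_cvg; apply: series_le_cvg cw => n; rewrite /telescope/= ?normr_ge0//.
  exact: le_trans (rw n).
rewrite (_ : r = (fun n => r 0%N + series (telescope r) n)); last first.
  by apply/funext => n; rewrite -eq_sum_telescope.
by apply: is_cvgD => //; exact: is_cvg_cst.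
Qed.

Lemma geometric_sum_half (n : nat) :
  \sum_(0 <= k < n) ((2 ^- k) : R) = 2 - 2 * 2 ^- n.
Proof.
elim: n => [|n IH]; first by rewrite big_nil expr0 invr1 mulr1 subrr.
rewrite big_nat_recr//= IH exprS invfM; set x := (2 ^+ n)^-1.
by rewrite (_ : 2 * (2^-1 * x) = x); [ring|rewrite mulrA divff ?mul1r// pnatr_eq0].
Qed.

(** The weighted squares [b n = 2^n |u (n+1) - u n|^2] have integral at most [2^-n], so their sum is
    finite almost everywhere. Since [y <= 1 + y^2] with [y = 2^n |u (n+1) - u n|], the increments
    are at most [2^-n + b n], hence summable, and Minkowski's inequality is not called for. *)
Lemma L2_ae_limit (u : nat -> R -> R[i]) :
  (forall n, L2 (u n)) ->
  (forall n, norm2 (fun t => u n.+1 t - u n t) ^+ 2 <= 4 ^- n) ->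
  exists2 g, cmeas g & {ae mu, forall t, I01 t ->
     (fun n => Re (u n t)) @ \oo --> Re (g t) /\
     (fun n => Im (u n t)) @ \oo --> Im (g t)}.
Proof.
move=> Lu du.
pose b n t := (2 : R) ^+ n * normc (u n.+1 t - u n t) ^+ 2.
have b0 n t : 0 <= b n t by rewrite mulr_ge0 ?sqr_ge0 ?exprn_ge0.
have ib n : mu.-integrable I01 (EFin \o b n).
  by apply: integrableZ; apply: L2_integrable; exact: L2B.
have mb n : measurable_fun I01 (fun t => (b n t)%:E).
  by have /measurable_int := ib n.
pose S t := (\sum_(0 <= n <oo) (b n t)%:E)%E.
have mS : measurable_fun I01 S.
  by apply: ge0_emeasurable_sum => // n t _ _; rewrite lee_fin.
have S0 t : (0 <= S t)%E by apply: nneseries_ge0 => n _ _; rewrite lee_fin.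
have intS : (\int[mu]_(t in I01) S t <= 2%:E)%E.
  rewrite integral_nneseries//; last by move=> n t _; rewrite lee_fin.
  apply: (@le_trans _ _ (\sum_(0 <= n <oo) (2 ^- n)%:E)%E).
    apply: lee_nneseries => [n _ _|n _].
      by apply: integral_ge0 => t _; rewrite lee_fin.
    rewrite -[leLHS](fineK (integrable_fin_num mI01 (ib n))) lee_fin.
    rewrite -/(Rintegral _ _ _) RintegralZl; [|exact: mI01|]; last first.
      by apply: L2_integrable; exact: L2B.
    have -> : \int[mu]_(t in I01) (normc (u n.+1 t - u n t) ^+ 2) =
        norm2 (fun t => u n.+1 t - u n t) ^+ 2.
      by rewrite sqr_sqrtr//; apply: Rintegral_ge0 => t _; exact: sqr_ge0.
    apply: le_trans (ler_wpM2l _ (du n)) _; first by rewrite exprn_ge0.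
    rewrite (_ : 4 = 2 * 2 :> R); last by ring.
    by rewrite exprMn invfM mulrA divff ?mul1r// expf_neq0// pnatr_eq0.
  apply: lime_le.
    by apply: is_cvg_nneseries => n _ _; rewrite lee_fin invr_ge0 exprn_ge0.
  apply: nearW => n; rewrite sumEFin lee_fin geometric_sum_half.
  by rewrite gerBl mulr_ge0// invr_ge0 exprn_ge0.
have iS : mu.-integrable I01 S.
  apply/integrableP; split => //; under eq_integral do rewrite gee0_abs//.
  by apply: le_lt_trans intS _; rewrite ltry.
have [N [mN N0 SN]] := integrable_ae mI01 iS.
have cvgS t : I01 t -> ~ N t -> cvgn (fun n => Re (u n t)) /\ cvgn (fun n => Im (u n t)).
  move=> It Nt.
  have Sfin : S t \is a fin_num.
    by apply: contrapT => Sn; apply: Nt; apply: SN => /= /(_ It).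
  have cb : cvgn (series (b ^~ t)).
    by apply: nnseries_is_cvg => //; rewrite -/(S t) ltey_eq Sfin.
  have cw : cvgn (series (fun n => 2 ^- n + b n t)).
    have cg : cvgn (series (geometric (1 : R) (2^-1))).
      by apply: is_cvg_geometric_series; rewrite ger0_norm ?invr_ge0// invf_lt1// ltr1n.
    rewrite (_ : series _ = series (geometric (1 : R) (2^-1)) + series (b ^~ t)).
      exact: is_cvgD.
    rewrite -seriesD; congr series; apply/funext => n.
    by change (2 ^- n + b n t = 1 * 2^-1 ^+ n + b n t); rewrite mul1r exprVn.
  have bd n : normc (u n.+1 t - u n t) <= 2 ^- n + b n t.
    rewrite /b; set x := normc _.
    have p0 : (0 : R) < 2 ^+ n by rewrite exprn_gt0.
    rewrite -(ler_pM2l p0) mulrDr divff ?gt_eqF// mulrA -expr2.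
    rewrite -exprMn; have := sqr_ge0 (2 ^+ n * x - 1).
    have := normc_ge0 (u n.+1 t - u n t).
    rewrite -/x; set y := _ * x.
    nra.
  split; apply: cvg_of_summable_increments cw => n.
    apply: le_trans (bd n); apply: le_trans (Re_le_normc _).
    by rewrite ReD; case: (u n t).
  apply: le_trans (bd n); apply: le_trans (Im_le_normc _).
  by rewrite ImD; case: (u n t).
(* Killing the sequence on the null set [N] makes it converge at every point of the interval, so
   that its pointwise limit is measurable. *)
pose chi := \1_(~` N) : R -> R.
pose v n t := (chi t)%:C * u n t.
have Rv n t : Re (v n t) = chi t * Re (u n t) by rewrite ReM/= mul0r subr0.
have Iv n t : Im (v n t) = chi t * Im (u n t) by rewrite ImM/= mul0r addr0.
have mv n : cmeas (v n).
  apply: cmeasM; last exact/L2_cmeas.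
  split; last exact: measurable_cst.
  by apply: measurable_indic; exact: measurableC.
have cv t : I01 t -> cvgn (fun n => Re (v n t)) /\ cvgn (fun n => Im (v n t)).
  move=> It; have [Nt|Nt] := pselect (N t).
    have c0 : chi t = 0 by rewrite /chi indicE memNset//= => /(_ Nt).
    split.
      rewrite (_ : (fun n => _) = (fun=> 0)); first exact: is_cvg_cst.
      by apply/funext => n; rewrite Rv c0 mul0r.
    rewrite (_ : (fun n => _) = (fun=> 0)); first exact: is_cvg_cst.
    by apply/funext => n; rewrite Iv c0 mul0r.
  have c1 : chi t = 1 by rewrite /chi indicE mem_set.
  have [c2 c3] := cvgS _ It Nt; split.
    by under eq_fun do rewrite Rv c1 mul1r.
  by under eq_fun do rewrite Iv c1 mul1r.
exists (fun t => limn (fun n => Re (v n t)) +i* limn (fun n => Im (v n t))).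
  split => /=.
    apply: (@measurable_fun_cvg _ _ _ _ (fun n t => Re (v n t))).
      by move=> n; have [] := mv n.
    by move=> t It; have [] := cv _ It.
  apply: (@measurable_fun_cvg _ _ _ _ (fun n t => Im (v n t))).
    by move=> n; have [] := mv n.
  by move=> t It; have [] := cv _ It.
exists N; split => // t /= H; apply: contrapT => Nt; apply: H => It.
have [c2 c3] := cv _ It.
have c1 : chi t = 1 by rewrite /chi indicE mem_set.
split.
  by move: c2; rewrite (_ : (fun n => Re (v n t)) = (fun n => Re (u n t)))//;
    apply/funext => n; rewrite Rv c1 mul1r.
by move: c3; rewrite (_ : (fun n => Im (v n t)) = (fun n => Im (u n t)))//;
  apply/funext => n; rewrite Iv c1 mul1r.
Qed.

(** The hypothesis bounds the distance from [u n] to every later term, so Fatou's lemma, applied in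
    [m] for fixed [n], passes the same bound to the almost everywhere limit. *)
Lemma L2_complete (u : nat -> R -> R[i]) :
  (forall n, L2 (u n)) ->
  (forall n m, norm2 (fun t => u (m + n)%N t - u n t) ^+ 2 <= 4 ^- n) ->
  exists2 g, L2 g & forall n, norm2 (fun t => u n t - g t) ^+ 2 <= 4 ^- n.
Proof.
move=> Lu du; have [|g mg ug] := L2_ae_limit Lu; first by move=> n; exact: (du n 1%N).
pose F n m t := ((normc (u n t - u (m + n)%N t)) ^+ 2)%:E : \bar R.
have L2F n m : L2 (fun t => u n t - u (m + n)%N t) by exact: L2B.
have mF n m : measurable_fun I01 (F n m).
  by have /measurable_int := L2_integrable (L2F n m).
have F0 n m t : (0 <= F n m t)%E by rewrite lee_fin sqr_ge0.
have intF n m : (\int[mu]_(t in I01) F n m t <= (4 ^- n)%:E)%E.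
  rewrite -(fineK (integrable_fin_num mI01 (L2_integrable (L2F n m)))) lee_fin.
  apply: le_trans (du n m).
  rewrite -/(Rintegral _ _ _) -[leLHS]sqr_sqrtr; last first.
    by apply: Rintegral_ge0 => t _; exact: sqr_ge0.
  rewrite le_eqVlt; apply/orP; left; apply/eqP; congr (_ ^+ 2).
  apply: norm2_aeq => //; first exact: L2B.
  by apply: aeW => t _; rewrite -normcN opprB.
have limF n : {ae mu, forall t, I01 t ->
    limn_einf (F n ^~ t) = ((normc (u n t - g t)) ^+ 2)%:E}.
  move: ug; apply: ae_imp => t + It => /(_ It) [ur ui].
  have e z1 z2 : normc (z1 - z2 : R[i]) ^+ 2 =
      (Re z1 - Re z2) * (Re z1 - Re z2) + (Im z1 - Im z2) * (Im z1 - Im z2).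
    by rewrite normc_sqr; case: z1 z2 => [? ?] [? ?].
  have cR : (fun m => normc (u n t - u (m + n)%N t) ^+ 2) @ \oo -->
      normc (u n t - g t) ^+ 2.
    rewrite e; under eq_fun do rewrite e.
    have c1 : (fun m => Re (u n t) - Re (u (m + n)%N t)) @ \oo --> Re (u n t) - Re (g t).
      by apply: cvgB; [exact: cvg_cst|rewrite (cvg_shiftn n (fun m => Re (u m t)))].
    have c2 : (fun m => Im (u n t) - Im (u (m + n)%N t)) @ \oo --> Im (u n t) - Im (g t).
      by apply: cvgB; [exact: cvg_cst|rewrite (cvg_shiftn n (fun m => Im (u m t)))].
    exact: cvgD (cvgM c1 c1) (cvgM c2 c2).
  have cF : F n ^~ t @ \oo --> ((normc (u n t - g t)) ^+ 2)%:E.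
    by apply/fine_cvgP; split; [exact: nearW|exact: cR].
  rewrite is_cvg_limn_einfE; last by apply/cvg_ex; eexists; exact: cF.
  exact: cvg_lim cF.
have mG n : measurable_fun I01 (fun t => ((normc (u n t - g t)) ^+ 2)%:E).
  by apply/measurable_EFinP; apply: measurable_normc2; apply: cmeasB => //; exact: L2_cmeas.
have intG n : (\int[mu]_(t in I01) ((normc (u n t - g t)) ^+ 2)%:E <= (4 ^- n)%:E)%E.
  have ml : measurable_fun I01 (fun t => limn_einf (F n ^~ t)).
    apply: measurableT_comp => //; apply: measurable_fun_limn_esup => m.
    exact: measurableT_comp.
  rewrite -(ae_eq_integral _ _ mI01 ml (mG n) (limF n)).
  apply: le_trans (fatou mu mI01 (mF n) (fun m t _ => F0 n m t)) _.
  rewrite limn_einf_lim; apply: lime_le; first exact: is_cvg_einfs.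
  apply: nearW => m; apply: le_trans (intF n m).
  by apply: ereal_inf_lbound; exists m => /=.
have Ld n : L2 (fun t => u n t - g t).
  have [m1 m2] : cmeas (fun t => u n t - g t) by apply: cmeasB => //; exact: L2_cmeas.
  by split => //; apply: le_lt_trans (intG n) _; rewrite ltry.
(* Only [u n - g] is known to be in L2 so far; [g] is recovered as [u 0 - (u 0 - g)]. *)
exists g.
  by have := L2B (Lu 0%N) (Ld 0%N); congr L2; apply/funext => t; rewrite subKr.
move=> n; rewrite sqr_sqrtr; last by apply: Rintegral_ge0 => t _; exact: sqr_ge0.
by rewrite -lee_fin fineK//; exact: (integrable_fin_num mI01 (L2_integrable (Ld n))).
Qed.

Lemma le0_of_le_geometric (x c : R) : (forall n, x <= c * 4 ^- n) -> x <= 0.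
Proof.
move=> H.
have cv : (fun n => c * (4^-1) ^+ n) @ \oo --> (0 : R).
  rewrite -(mulr0 c); apply: cvgM; first exact: cvg_cst.
  apply: cvg_expr; rewrite ger0_norm ?invr_ge0// invf_lt1// ltr1n//.
rewrite -(cvg_lim _ cv)//; apply: limr_ge; first by apply/cvg_ex; eexists; exact: cv.
by apply: nearW => n; rewrite exprVn.
Qed.

Theorem orthogonal_projection (N : set (R -> R[i])) f : closed_subspace N -> L2 f ->
  exists2 p, N p & forall k, N k -> inner_prod (fun t => f t - p t) k = 0.
Proof.
move=> [NL N0 Nlin Nlim] Lf.
pose dist g := norm2 (fun t => f t - g t) ^+ 2.
pose E := [set dist g | g in N].
have hE : has_inf E.
  split; first by exists (dist (fun=> 0)); exists (fun=> 0).
  by exists 0 => _ [g _ <-]; exact: sqr_ge0.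
pose d := inf E.
have dle g : N g -> d <= dist g by move=> Ng; apply: ge_inf; [exact: hE.2|exists g].
(* The parallelogram law will bound [norm2 (u (m+n) - u n) ^+ 2] by twice the sum of the two
   excesses over [d]. The quarter makes this at most [4^-n], the rate required by [L2_complete]. *)
have ex n : exists g, N g /\ dist g < d + 4 ^- n / 4.
  have [|_ [g Ng <-] gd] := inf_adherent (_ : 0 < 4 ^- n / 4) hE.
    by rewrite divr_gt0// invr_gt0 exprn_gt0.
  by exists g.
have [u Hu] := choice ex.
have Nu n : N (u n) by have [] := Hu n.
have Lu n : L2 (u n) by exact: NL.
have ud n : dist (u n) < d + 4 ^- n / 4 by have [] := Hu n.
have Ldu n : L2 (fun t => f t - u n t) by exact: L2B.
have mono n m : (4 : R) ^- (m + n) <= 4 ^- n.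
  by rewrite lef_pV2 ?posrE ?exprn_gt0// ler_weXn2l ?ler1n// leq_addl.
have NZ a g : N g -> N (fun t => a * g t).
  by move=> Ng; have := Nlin a _ _ Ng N0; congr N; apply/funext => t; rewrite addr0.
have ND g1 g2 : N g1 -> N g2 -> N (fun t => g1 t + g2 t).
  by move=> N1 N2; have := Nlin 1 _ _ N1 N2; congr N; apply/funext => t; rewrite mul1r.
have du n m : norm2 (fun t => u (m + n)%N t - u n t) ^+ 2 <= 4 ^- n.
  pose x t := f t - u n t; pose y t := f t - u (m + n)%N t.
  have mid : N (fun t => 2^-1%:C * (u n t + u (m + n)%N t)) by apply: NZ; exact: ND.
  have Lx : L2 x := Ldu n; have Ly : L2 y := Ldu (m + n)%N.
  (* The sum [x + y] is written as a difference so that [norm2_sub_sqr] yields both halves of the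
     parallelogram law. *)
  have Lxy : L2 (fun t => x t - (- 1) * y t) by apply: L2B => //; exact: L2Z.
  have e1 : norm2 (fun t => u (m + n)%N t - u n t) ^+ 2 =
      dist (u n) + dist (u (m + n)%N) - 2 * Re (inner_prod x y).
    rewrite -[RHS]norm2_sub_sqr//; congr (norm2 _ ^+ 2).
    by apply/funext => t; rewrite /x /y; ring.
  have e2 : 4 * dist (fun t => 2^-1%:C * (u n t + u (m + n)%N t)) =
      dist (u n) + dist (u (m + n)%N) + 2 * Re (inner_prod x y).
    have -> : 4 * dist (fun t => 2^-1%:C * (u n t + u (m + n)%N t)) =
        norm2 (fun t => x t - (- 1) * y t) ^+ 2.
      have -> : dist (fun t => 2^-1%:C * (u n t + u (m + n)%N t)) =
        norm2 (fun t => 2^-1%:C * (x t - (- 1) * y t)) ^+ 2.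
        congr (norm2 _ ^+ 2); apply/funext => t; rewrite /x /y.
        have h : (2^-1%:C : R[i]) + 2^-1%:C = 1.
          by apply: complexP; rewrite ?ReD ?ImD/= ?addr0//; lra.
        set c := 2^-1%:C in h *; set w := c * (u n t + _).
        by rewrite (_ : f t - w = (c + c) * f t - w); [rewrite /w; ring|rewrite h mul1r].
      rewrite norm2Z//= expr0n/= addr0 sqr_sqrtr ?sqr_ge0//.
      by field.
    rewrite (norm2_sub_sqr Lx (L2Z _ Ly)) (norm2Z _ Ly) (ipZr _ Ly Lx).
    have -> : normc (-1 : R[i]) ^+ 2 = 1 by rewrite normc_sqr/= sqrrN expr1n oppr0 expr0n addr0.
    have -> : (- 1 : R[i])^* = -1 by rewrite conjcN conjc1E.
    rewrite mul1r mulN1r (_ : Re (- _) = - Re (inner_prod x y)); last by case: inner_prod.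
    by rewrite /dist /x /y; ring.
  have := dle _ mid; have := ud n; have := ud (m + n)%N; have := mono n m.
  rewrite e1; move: e2; set q := dist _ => e2; lra.
have [p Lp up] := L2_complete Lu du.
have cvp : (fun n => norm2 (u n \- p)) @ \oo --> (0 : R).
  have cv : (fun n => (2^-1 : R) ^+ n) @ \oo --> (0 : R).
    by apply: cvg_expr; rewrite ger0_norm ?invr_ge0// invf_lt1// ltr1n.
  apply: (squeeze_cvgr _ (cvg_cst 0) cv); apply: nearW => n.
  rewrite norm2_ge0/= -(@ler_pXn2r _ 2%N)// ?nnegrE ?norm2_ge0 ?exprn_ge0 ?invr_ge0//.
  apply: le_trans (up n) _.
  by rewrite exprAC exprVn (_ : 2 ^+ 2 = 4 :> R) ?exprVn//; ring.
have Np : N p by exact: Nlim cvp.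
exists p => // k Nk; have Lk := NL _ Nk.
(* Orthogonality is tested on the minimizing sequence: moving [u n] by its best multiple [lam k]
   lowers [dist] by [|c|^2 / B], and the result cannot fall below [d]. *)
have bnd n : normc (inner_prod (fun t => f t - u n t) k) ^+ 2 <=
    norm2 k ^+ 2 * 4 ^- n.
  set c := inner_prod _ _; set B := norm2 k ^+ 2.
  have B0 : 0 <= B by exact: sqr_ge0.
  have [Bz|Bnz] := eqVneq B 0.
    have := cauchy_schwarz (Ldu n) Lk; rewrite -/c => CS.
    have k0 : norm2 k = 0 by apply/eqP; rewrite -sqrf_eq0 -/B Bz.
    have -> : normc c = 0 by apply/eqP; rewrite eq_le normc_ge0 (le_trans CS)// k0 mulr0.
    by rewrite Bz mul0r expr0n.
  have Bp : 0 < B by rewrite lt_def Bnz B0.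
  pose lam := (B^-1)%:C * c.
  have := dle _ (Nlin lam _ _ Nk (Nu n)).
  have -> : dist (fun t => lam * k t + u n t) =
      norm2 (fun t => (f t - u n t) - lam * k t) ^+ 2.
    by congr (norm2 _ ^+ 2); apply/funext => t; ring.
  rewrite norm2_sub_sqr//; last exact: L2Z.
  set C := normc c ^+ 2.
  have nl : normc lam ^+ 2 = B^-2 * C.
    rewrite /lam normcM exprMn; congr (_ * _).
    by rewrite normc_sqr/= expr0n/= addr0 exprVn.
  have cl : lam^* * c = (B^-1 * C)%:C.
    rewrite /lam conjcM -mulrA [c^* * c]mulrC mulcJE.
    have -> : (B^-1)%:C^* = (B^-1)%:C by apply: complexP => //=; rewrite oppr0.
    by rewrite -rmorphM.
  rewrite (norm2Z _ Lk) (ipZr _ Lk (Ldu n)) -/c -/B nl cl /= => H.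
  have C0 : 0 <= C by exact: sqr_ge0.
  have H2 : B^-2 * C * B = B^-1 * C by field.
  have := ud n; rewrite /dist => H3.
  have e0 : (0 : R) <= 4 ^- n by rewrite invr_ge0 exprn_ge0.
  have H4 : B^-1 * C <= 4 ^- n by rewrite H2 in H; lra.
  by rewrite -(ler_pM2l (_ : 0 < B^-1)) ?invr_gt0// mulKf.
apply: eq0_normc; apply/eqP; rewrite -sqrf_eq0 eq_le sqr_ge0 andbT.
(* [<f - p, k>] splits at [u n] into two terms whose squares are at most [norm2 k ^+ 2 * 4^-n];
   [normcD_sqr] doubles each, hence the 4. *)
apply: (@le0_of_le_geometric _ (4 * norm2 k ^+ 2)) => n.
have Lup : L2 (fun t => u n t - p t) by exact: L2B.
have -> : inner_prod (fun t => f t - p t) k =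
    inner_prod (fun t => f t - u n t) k + inner_prod (fun t => u n t - p t) k.
  by rewrite -ipDl//; congr inner_prod; apply/funext => t; rewrite addrA subrK.
apply: le_trans (normcD_sqr _ _) _.
have := bnd n.
have CS : normc (inner_prod (fun t => u n t - p t) k) ^+ 2 <=
    norm2 (fun t => u n t - p t) ^+ 2 * norm2 k ^+ 2.
  by rewrite -exprMn lerXn2r ?nnegrE ?normc_ge0 ?mulr_ge0 ?norm2_ge0// cauchy_schwarz.
have : norm2 (fun t => u n t - p t) ^+ 2 * norm2 k ^+ 2 <= 4 ^- n * norm2 k ^+ 2.
  by rewrite ler_wpM2r ?sqr_ge0.
lra.
Qed.

End Completeness.

(** * Uniqueness of Fourier coefficients *)

Section StepApproximation.
Variable R : realType.
Implicit Types x u : R.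

(** The polynomials of the Brosowski-Deutsch proof of the Stone-Weierstrass theorem. On [[0, 1]]
    they tend to 1 below [1/2] and to 0 above it, according to whether [2^n x^n] tends to 0 or to
    infinity. *)
Definition bump (n : nat) x := (1 - x ^+ n) ^+ (2 ^ n).

Lemma bernoulli_ge (m : nat) u : 0 <= u <= 1 -> 1 - m%:R * u <= (1 - u) ^+ m.
Proof.
move=> /andP[u0 u1]; elim: m => [|m IH]; first by rewrite mul0r subr0 expr0.
have v0 : 0 <= 1 - u by rewrite subr_ge0.
rewrite exprS; have := ler_wpM2l v0 IH; rewrite -natr1.
have : 0 <= m%:R * u * u :> R by rewrite !mulr_ge0// ler0n.
nra.
Qed.

(** [m u <= (1 + u)^m] by Bernoulli, and [(1 - u) (1 + u) <= 1]. *)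
Lemma bernoulli_le (m : nat) u : 0 <= u <= 1 -> (1 - u) ^+ m * (m%:R * u) <= 1.
Proof.
move=> /andP[u0 u1].
have H : m%:R * u <= (1 + u) ^+ m.
  elim: m => [|m IH]; first by rewrite mul0r expr0 ler01.
  have P : 1 <= (1 + u) ^+ m by rewrite exprn_ege1// lerDl.
  rewrite exprS -natr1; nra.
have v0 : 0 <= (1 - u) ^+ m by rewrite exprn_ge0// subr_ge0.
apply: le_trans (ler_wpM2l v0 H) _; rewrite -exprMn exprn_ile1//.
  by rewrite mulr_ge0 ?subr_ge0 ?addr_ge0.
nra.
Qed.

Lemma bump_itv (n : nat) x : 0 <= x <= 1 -> 0 <= bump n x <= 1.
Proof.
move=> /andP[x0 x1]; have y0 : 0 <= x ^+ n by exact: exprn_ge0.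
have y1 : x ^+ n <= 1 by rewrite exprn_ile1.
by rewrite exprn_ge0 ?subr_ge0// exprn_ile1 ?subr_ge0// gerBl.
Qed.

Lemma bump_cvg1 x : 0 <= x -> x < 2^-1 -> bump ^~ x @ \oo --> (1 : R).
Proof.
move=> x0 xh; have x1 : x <= 1 by apply: ltW; apply: lt_trans xh _; rewrite invf_lt1// ltr1n.
have cv : (fun n => 1 - (2 * x) ^+ n) @ \oo --> (1 : R).
  rewrite -[X in _ --> X]subr0; apply: cvgB; first exact: cvg_cst.
  by apply: cvg_expr; rewrite ger0_norm ?mulr_ge0//; lra.
apply: (squeeze_cvgr _ cv (cvg_cst (1 : R))); apply: nearW => n.
have /andP[_ ->] := @bump_itv n x ltac:(by rewrite x0 x1).
rewrite andbT; apply: le_trans (bernoulli_ge _ _).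
  by rewrite natrX -exprMn.
by rewrite exprn_ge0// exprn_ile1.
Qed.

Lemma bump_cvg0 x : x <= 1 -> 2^-1 < x -> bump ^~ x @ \oo --> (0 : R).
Proof.
move=> x1 xh; have x0 : 0 < x by apply: lt_trans xh; rewrite invr_gt0.
have x2 : 1 < 2 * x by lra.
have cv : (fun n => (2 * x)^-1 ^+ n) @ \oo --> (0 : R).
  apply: cvg_expr; rewrite ger0_norm ?invr_ge0 ?mulr_ge0 ?(ltW x0)//.
  by rewrite invf_lt1// (lt_trans _ x2).
apply: (squeeze_cvgr _ (cvg_cst (0 : R)) cv); apply: nearW => n.
have /andP[-> _] := @bump_itv n x ltac:(by rewrite (ltW x0) x1).
have p0 : 0 < (2 * x) ^+ n by rewrite exprn_gt0// (lt_trans _ x2).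
rewrite /= exprVn -[leRHS]mul1r ler_pdivlMr// exprMn -natrX.
by apply: bernoulli_le; rewrite exprn_ge0 ?(ltW x0)//= exprn_ile1// ltW.
Qed.

End StepApproximation.

(** * Real functions: from trigonometric polynomials to integrals over [[0, b]] *)

Section FourierUniquenessReal.
Variable R : realType.
Local Notation mu := (@lebesgue_measure R).
Local Notation I01 := (`[0, 1]%classic : set R).

(* The level set [arc b t < 1/2] of this trigonometric polynomial in [2 pi t] is [t < b]. *)
Definition arc (b t : R) : R := 2^-1 - sin (pi * t) * sin (pi * (b - t)) / 2.

Lemma arc_itv b t : 0 <= arc b t <= 1.
Proof.
have := sin_max (pi * t); have := sin_max (pi * (b - t)).
rewrite !ler_norml /arc => /andP[h1 h2] /andP[h3 h4]; apply/andP; split; nra.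
Qed.

(** Each sine in [arc] has half the frequency of [zeta]; only their product is a trigonometric
    polynomial of degree one on the circle. *)
Lemma arcE b t : arc b t = 2^-1 -
  (cos (pi * b) * cos (2 * pi * t) + sin (pi * b) * sin (2 * pi * t) - cos (pi * b)) / 4.
Proof.
rewrite /arc (_ : 2 * pi * t = pi * t + pi * t); last by ring.
rewrite mulrBr sinB cosD sinD; have := cos2Dsin2 (pi * t).
set c := cos (pi * t); set s := sin (pi * t); set cb := cos _; set sb := sin _ => h.
have -> : c * c = 1 - s * s by rewrite -h; ring.
by field.
Qed.

Lemma arc_lt b t : 0 < b < 1 -> 0 < t < 1 -> t < b -> arc b t < 2^-1.
Proof.
move=> /andP[b0 b1] /andP[t0 t1] tb.
have p0 : 0 < pi :> R := pi_gt0 R.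
rewrite /arc gtrBl divr_gt0// mulr_gt0// sin_gt0_pi//; apply/andP; split.
- by rewrite mulr_gt0.
- by rewrite gtr_pMr.
- by rewrite mulr_gt0// subr_gt0.
- by rewrite gtr_pMr//; lra.
Qed.

Lemma arc_gt b t : 0 < b < 1 -> 0 < t < 1 -> b < t -> 2^-1 < arc b t.
Proof.
move=> /andP[b0 b1] /andP[t0 t1] tb.
have p0 : 0 < pi :> R := pi_gt0 R.
rewrite /arc ltrDl -opprB mulrN sinN mulrN mulNr opprK.
rewrite divr_gt0// mulr_gt0// sin_gt0_pi//; apply/andP; split.
- by rewrite mulr_gt0.
- by rewrite gtr_pMr.
- by rewrite mulr_gt0// subr_gt0.
- by rewrite gtr_pMr//; lra.
Qed.

Lemma measurable_arc b (D : set R) : measurable_fun D (arc b).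
Proof.
apply: (measurable_funS measurableT) => //; apply: continuous_measurable_fun => t.
have cl (c : R) : {for t, continuous (fun x => pi * (c - x))}.
  by apply: cvgM; [exact: cvg_cst|apply: cvgB; [exact: cvg_cst|exact: cvg_id]].
apply: cvgB; first exact: cvg_cst.
apply: cvgM; last exact: cvg_cst.
apply: cvgM.
  apply: (@continuous_comp _ _ _ (fun x => pi * x) sin); last exact: continuous_sin.
  by apply: cvgM; [exact: cvg_cst|exact: cvg_id].
by apply: (@continuous_comp _ _ _ (fun x => pi * (b - x)) sin); [exact: cl|exact: continuous_sin].
Qed.

(** [bump n (arc b t)] is bounded by 1 and converges almost everywhere to the indicator of [[0, b]],
    so dominated convergence applies with [|f|] as majorant. *)
Lemma integral_arc0 (f : R -> R) : mu.-integrable I01 (EFin \o f) ->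
  (forall b n, \int[mu]_(t in I01) (bump n (arc b t) * f t) = 0) ->
  forall b, 0 < b < 1 -> \int[mu]_(t in `[0, b]) f t = 0.
Proof.
move=> intf H b b01; have [mf _] := (integrableP _ _ _ intf).
pose g n t := (bump n (arc b t) * f t)%:E.
pose l t := ((\1_`[0, b]) t * f t)%:E : \bar R.
have mb n : measurable_fun I01 (fun t => bump n (arc b t)).
  rewrite /bump; apply: measurable_funX; apply: measurable_funB; first exact: measurable_cst.
  by apply: measurable_funX; exact: measurable_arc.
have mf' : measurable_fun I01 f by exact/measurable_EFinP.
have mg n : measurable_fun I01 (g n).
  by apply/measurable_EFinP; exact: measurable_funM.
have ml : measurable_fun I01 l.
  by apply/measurable_EFinP; apply: measurable_funM => //; exact: measurable_indic.
have gl : {ae mu, forall t, I01 t -> g ^~ t @ \oo --> l t}.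
  (* At these three points [arc b] equals [1/2], where the limit of [bump] is left undetermined. *)
  exists ([set 0] `|` [set 1] `|` [set b]); split.
  - by apply: measurableU; [apply: measurableU|]; exact: measurable_set1.
  - apply: null_set_setU; [apply: measurableU|..];
      [exact: measurable_set1..| |exact: lebesgue_measure_set1].
    by apply: null_set_setU;
      [exact: measurable_set1..|exact: lebesgue_measure_set1|exact: lebesgue_measure_set1].
  move=> t /= nH; apply: contrapT => /not_orP[/not_orP[t0 t1] tb]; apply: nH.
  rewrite /= in_itv/= => /andP[t0' t1'].
  have t01 : 0 < t < 1 by rewrite !lt_neqAle t0' t1' !andbT eq_sym; apply/andP; split; exact/eqP.
  apply: cvg_EFin; first exact: nearW.
  rewrite /l/=; apply: cvgM; last exact: cvg_cst.
  have [a0 a1] := andP (arc_itv b t).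
  have [tlb|blt|//] := ltgtP t b.
    rewrite indicE mem_set/= ?in_itv/= ?t0' ?ltW//.
    by apply: bump_cvg1 => //; exact: arc_lt.
  rewrite indicE memNset/=; last by rewrite in_itv/= t0'/= leNgt blt.
  by apply: bump_cvg0 => //; exact: arc_gt.
have gf : {ae mu, forall t n, I01 t -> (`|g n t| <= `|(f t)%:E|)%E}.
  apply: aeW => t n It; rewrite lee_fin normrM.
  have /andP[h1 h2] := bump_itv n (arc_itv b t).
  by rewrite (ger0_norm h1) -[leRHS]mul1r ler_wpM2r.
have [_ _] := dominated_convergence mI01 mg ml gl (integrable_abse intf) gf.
rewrite (_ : [sequence _]_n = (fun=> 0%E)); last first.
  apply/funext => n /=; rewrite -[LHS]fineK ?[fine _]H//.
  apply: (integrable_fin_num mI01); apply: (le_integrable mI01 (mg n) _ intf) => t It.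
  rewrite lee_fin normrM; have /andP[h1 h2] := bump_itv n (arc_itv b t).
  by rewrite (ger0_norm h1) -[leRHS]mul1r ler_wpM2r.
move=> cv0; have e : (0 = \int[mu]_(t in I01) l t)%E.
  by rewrite -(cvg_lim (@ereal_hausdorff R) cv0) lim_cst.
have [b0 b1] := andP b01.
have sub : `[0, b]%classic `<=` I01.
  by move=> t; rewrite /= !in_itv/= => /andP[-> /le_trans]; apply; exact: ltW.
transitivity (fine (\int[mu]_(t in I01) l t)); last by rewrite -e.
rewrite -(setIidr sub) Rintegral_mkcondr /Rintegral; congr (fine _).
by apply: eq_integral => t _; rewrite patch_indic /= mulrC.
Qed.

(** By Lebesgue's differentiation theorem [f] is almost everywhere the derivative of its primitive,
    which vanishes on []0, 1[]. The extension [g] by zero is there because that theorem is used on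
    the whole line. *)
Lemma ae0_of_integral_itv0 (f : R -> R) : mu.-integrable I01 (EFin \o f) ->
  (forall b, 0 < b < 1 -> \int[mu]_(t in `[0, b]) f t = 0) ->
  {ae mu, forall t, I01 t -> f t = 0}.
Proof.
move=> intf H; pose g := f \_ I01.
have ig : mu.-integrable setT (EFin \o g).
  by rewrite /g -restrict_EFin; apply/integrable_restrict => //; rewrite setTI.
have lg : locally_integrable [set: R] g by exact: integrable_locally.
have ig' y : mu.-integrable `[0, y] (EFin \o g).
  by apply: integrableS ig => //; exact: measurable_itv.
have := FTC1 ig' lg => F1.
have n0 : {ae mu, forall t, t <> (0 : R)}.
  by exists [set 0]; split => //; [exact: lebesgue_measure_set1|move=> t /= /contrapT ->].
have n1 : {ae mu, forall t, t <> (1 : R)}.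
  by exists [set 1]; split => //; [exact: lebesgue_measure_set1|move=> t /= /contrapT ->].
have n01 : {ae mu, forall t, t <> (0 : R) /\ t <> (1 : R)}.
  by move: n0 n1; apply: ae_imp2 => t.
move: n01 F1; apply: ae_imp2 => t [t0 t1] + It.
have /andP[t0' t1'] : 0 <= t <= 1 by move: It; rewrite /= in_itv.
have tlt0 : 0 < t by rewrite lt_neqAle t0' andbT eq_sym; exact/eqP.
have tlt1 : t < 1 by rewrite lt_neqAle t1' andbT; exact/eqP.
move=> dF; have {dF}[|_ dF] := dF; first by rewrite /= lte_fin.
have -> : f t = g t by rewrite /g patchE mem_set.
rewrite -dF derive1E.
rewrite (near_eq_derive (g := cst 0)) ?derive_cst ?oner_neq0//.
have : t \in `]0, 1[ by rewrite in_itv/= tlt0 tlt1.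
move=> /near_in_itvoo; apply: filterS => y; rewrite in_itv/= => y01 /=.
transitivity (\int[mu]_(x in `[0, y]) f x); last exact: H.
apply: eq_Rintegral => x; rewrite inE/= in_itv/= => /andP[x0 xy].
rewrite /g patchE mem_set//= in_itv/= x0/= (le_trans xy)//.
by have /andP[_ /ltW] := y01.
Qed.

End FourierUniquenessReal.

(** * Complex functions: the uniqueness theorem *)

Section FourierUniqueness.
Variable R : realType.
Local Notation mu := (@lebesgue_measure R).
Local Notation I01 := (`[0, 1]%classic : set R).
Local Notation Re := complex.Re.
Local Notation Im := complex.Im.
Implicit Types (f g k : R -> R[i]) (a z : R[i]).

Lemma zetaMJ (t : R) : zeta t * (zeta t)^* = 1.
Proof.
rewrite mulcJE normc_sqr/= cos2Dsin2.
by apply: complexP.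
Qed.

Lemma zeta_neq0 (t : R) : zeta t != 0.
Proof. by apply/eqP => z0; have /eqP := zetaMJ t; rewrite z0 mul0r eq_sym oner_eq0. Qed.

Lemma zetaV (t : R) : (zeta t)^-1 = (zeta t)^*.
Proof. by apply: (mulfI (zeta_neq0 t)); rewrite divff ?zetaMJ// zeta_neq0. Qed.

Lemma conj_zetaX (t : R) (n : int) : (zeta t ^ n)^* = zeta t ^ (- n).
Proof.
have H (m : nat) : (zeta t ^+ m)^* = zeta t ^- m.
  by rewrite -exprVn zetaV; exact: rmorphXn.
case: n => n; first by rewrite -exprnN H.
by rewrite NegzE opprK -exprnN -H conjcKE.
Qed.

Lemma zetaXMJ (t : R) (n : int) : zeta t ^ n * (zeta t ^ n)^* = 1.
Proof. by rewrite conj_zetaX -expfzDr ?zeta_neq0// subrr expr0z. Qed.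

Lemma normc1E z : z * z^* = 1 -> normc z = 1.
Proof.
rewrite mulcJE => /(congr1 (@complex.Re R))/= /eqP.
by rewrite sqrf_eq1 => /orP[/eqP//|/eqP e]; have := normc_ge0 z; rewrite e ler0N1.
Qed.

Lemma normc_zetaX (t : R) (n : int) : normc (zeta t ^ n) = 1.
Proof. by apply: normc1E; exact: zetaXMJ. Qed.

Lemma cmeas_zeta : cmeas (@zeta R).
Proof.
split => /=; apply: (measurable_funS measurableT) => //;
  apply: continuous_measurable_fun => t.
  apply: (@continuous_comp _ _ _ (fun x => 2 * pi * x) cos); last exact: continuous_cos.
  by apply: cvgM; [exact: cvg_cst|exact: cvg_id].
apply: (@continuous_comp _ _ _ (fun x => 2 * pi * x) sin); last exact: continuous_sin.
by apply: cvgM; [exact: cvg_cst|exact: cvg_id].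
Qed.

Lemma cmeasX f n : cmeas f -> cmeas (fun t => f t ^+ n).
Proof.
move=> mf; elim: n => [|n IH]; first exact: cmeas_cst.
have -> : (fun t => f t ^+ n.+1) = (fun t => f t * f t ^+ n).
  by apply/funext => t; rewrite exprS.
exact: cmeasM.
Qed.

Lemma cmeas_zetaX (n : int) : cmeas (fun t : R => zeta t ^ n).
Proof.
case: n => n; first exact: cmeasX cmeas_zeta.
by apply: cmeasV; apply: cmeasX; exact: cmeas_zeta.
Qed.

(** Quantifying over all integers makes the property stable under multiplication by powers of
    [zeta], hence by every trigonometric polynomial; integrability is included so that [cint] is
    additive on the terms. *)
Definition all_coef0 f := forall n : int,
  cintegrable (fun t => f t * zeta t ^ n) /\ cint (fun t => f t * zeta t ^ n) = 0.

Lemma all_coef0D f g : all_coef0 f -> all_coef0 g -> all_coef0 (fun t => f t + g t).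
Proof.
move=> Hf Hg n; have [f1 f2] := Hf n; have [g1 g2] := Hg n.
have -> : (fun t => (f t + g t) * zeta t ^ n) =
    (fun t => f t * zeta t ^ n + g t * zeta t ^ n).
  by apply/funext => t; rewrite mulrDl.
by split; [exact: cintegrableD|rewrite cintD// f2 g2 addr0].
Qed.

Lemma all_coef0Z a f : all_coef0 f -> all_coef0 (fun t => a * f t).
Proof.
move=> Hf n; have [f1 f2] := Hf n.
have -> : (fun t => (a * f t) * zeta t ^ n) = (fun t => a * (f t * zeta t ^ n)).
  by apply/funext => t; rewrite mulrA.
by split; [exact: cintegrableZ|rewrite cintZ// f2 mulr0].
Qed.

Lemma all_coef0_zeta (m : int) f : all_coef0 f -> all_coef0 (fun t => zeta t ^ m * f t).
Proof.
move=> Hf n; have := Hf (m + n).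
have -> //: (fun t => zeta t ^ m * f t * zeta t ^ n) = (fun t => f t * zeta t ^ (m + n)).
by apply/funext => t; rewrite expfzDr ?zeta_neq0//; ring.
Qed.

Lemma arc_zeta (b t : R) : (arc b t)%:C =
  (2^-1 + cos (pi * b) / 4)%:C +
  ((- (cos (pi * b) / 8)) +i* (sin (pi * b) / 8)) * zeta t ^ 1 +
  ((- (cos (pi * b) / 8)) -i* (sin (pi * b) / 8)) * zeta t ^ (- 1).
Proof.
rewrite exprN1 zetaV expr1z arcE; apply: complexP;
  by rewrite ?(ReD, ImD) ?(ReM, ImM) ReJ ImJ /=; field.
Qed.

Lemma all_coef0_arc (b : R) f : all_coef0 f -> all_coef0 (fun t => (arc b t)%:C * f t).
Proof.
move=> Hf.
have := all_coef0D (all_coef0D (all_coef0Z _ Hf) (all_coef0Z _ (all_coef0_zeta 1 Hf)))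
  (all_coef0Z _ (all_coef0_zeta (-1) Hf)).
move=> /(_ (2^-1 + cos (pi * b) / 4)%:C ((- (cos (pi * b) / 8)) +i* (sin (pi * b) / 8))
  ((- (cos (pi * b) / 8)) -i* (sin (pi * b) / 8))).
by congr all_coef0; apply/funext => t; rewrite arc_zeta; ring.
Qed.

Lemma all_coef0_bump (b : R) n f : all_coef0 f ->
  all_coef0 (fun t => (bump n (arc b t))%:C * f t).
Proof.
move=> Hf.
have H1 m g : all_coef0 g -> all_coef0 (fun t => (arc b t ^+ m)%:C * g t).
  move=> Hg; elim: m => [|m IH].
    by move: Hg; congr all_coef0; apply/funext => t; rewrite expr0 mul1r.
  have := all_coef0_arc b IH; congr all_coef0; apply/funext => t.
  by rewrite exprS rmorphM/= mulrA.
have H2 g : all_coef0 g -> all_coef0 (fun t => (1 - arc b t ^+ n)%:C * g t).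
  move=> Hg; have := all_coef0D Hg (all_coef0Z (-1) (H1 n _ Hg)).
  by congr all_coef0; apply/funext => t; rewrite rmorphB/= rmorph1; ring.
rewrite /bump; elim: (2 ^ n)%N => [|m IH].
  by move: Hf; congr all_coef0; apply/funext => t; rewrite expr0 mul1r.
have := H2 _ IH; congr all_coef0; apply/funext => t.
by rewrite exprS rmorphM/= mulrA.
Qed.

(** Stated for integrable [f] because Beurling's theorem applies it to [|phi|^2 - 1], with [phi]
    known only to be in L2. *)
Theorem fourier_uniqueness f : cintegrable f ->
  (forall n : int, cint (fun t => f t * zeta t ^ n) = 0) -> aeq f (fun=> 0).
Proof.
move=> intf H.
have Hf : all_coef0 f.
  move=> n; split => //; have [i1 i2] := intf.
  have inf : mu.-integrable I01 (EFin \o (fun t => `|Re (f t)| + `|Im (f t)|)).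
    by apply: integrable_add; [exact: integrable_norm i1|exact: integrable_norm i2].
  apply: cintegrable_dom inf _.
    by apply: cmeasM; [exact: cintegrable_cmeas|exact: cmeas_zetaX].
  move=> t _; rewrite normcM normc_zetaX mulr1.
  rewrite -(@ler_pXn2r _ 2%N)// ?nnegrE ?normc_ge0 ?addr_ge0//.
  rewrite normc_sqr -(@real_normK _ (Re (f t))) ?num_real//.
  rewrite -(@real_normK _ (Im (f t))) ?num_real//.
  have := normr_ge0 (Re (f t)); have := normr_ge0 (Im (f t)).
  by set x := `|_|; set y := `|_|; nra.
have Hb b n : cint (fun t => (bump n (arc b t))%:C * f t) = 0.
  have [_ <-] := all_coef0_bump b n Hf 0; congr cint.
  by apply/funext => t; rewrite expr0z mulr1.
(* The test functions [bump n (arc b t)] are real, so the vanishing of [cint] splits into separate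
   statements on the real and imaginary parts of [f]. *)
have re : {ae mu, forall t, I01 t -> Re (f t) = 0}.
  have [i1 _] := intf; apply: (ae0_of_integral_itv0 i1); apply: integral_arc0 => // b n.
  transitivity (Re (cint (fun t => (bump n (arc b t))%:C * f t))); last by rewrite Hb.
  by apply: eq_Rintegral => t _; rewrite ReM/= mul0r subr0.
have im : {ae mu, forall t, I01 t -> Im (f t) = 0}.
  have [_ i1] := intf; apply: (ae0_of_integral_itv0 i1); apply: integral_arc0 => // b n.
  transitivity (Im (cint (fun t => (bump n (arc b t))%:C * f t))); last by rewrite Hb.
  by apply: eq_Rintegral => t _; rewrite ImM/= mul0r addr0.
move: re im; apply: ae_imp2 => t r i It; apply: complexP; rewrite ?r ?i//.
Qed.

End FourierUniqueness.

(** * The Hardy space and Beurling's theorem *)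

Section Hardy.
Variable R : realType.
Local Notation mu := (@lebesgue_measure R).
Local Notation I01 := (`[0, 1]%classic : set R).
Local Notation Re := complex.Re.
Local Notation Im := complex.Im.
Local Notation zX n := (fun t : R => zeta t ^ n).
Implicit Types (f g k : R -> R[i]) (a z : R[i]) (N L : set (R -> R[i])).

Lemma zeta_de_moivre (n : nat) (t : R) :
  zeta t ^+ n = cos (2 * pi * n%:R * t) +i* sin (2 * pi * n%:R * t).
Proof.
elim: n => [|n IH].
  by rewrite expr0 mulr0 mul0r cos0 sin0.
rewrite exprS IH; apply: complexP; rewrite (ReM, ImM)/= -[n.+1%:R]natr1.
  rewrite (_ : 2 * pi * (n%:R + 1) * t = 2 * pi * t + 2 * pi * n%:R * t); last by ring.
  by rewrite cosD.
rewrite (_ : 2 * pi * (n%:R + 1) * t = 2 * pi * t + 2 * pi * n%:R * t); last by ring.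
by rewrite sinD addrC.
Qed.

Lemma sin_2pi_nat (n : nat) : sin (2 * pi * n%:R : R) = 0 /\ cos (2 * pi * n%:R : R) = 1.
Proof.
elim: n => [|n [IH1 IH2]]; first by rewrite mulr0 sin0 cos0.
rewrite -[n.+1%:R]natr1 (_ : 2 * pi * (n%:R + 1) = 2 * pi * n%:R + pi *+ 2); last by ring.
by rewrite mulr2n addrA !(sinDpi, cosDpi) IH1 IH2; split; ring.
Qed.

Lemma cint_zetaX (n : nat) : cint (zX n.+1%:Z) = 0.
Proof.
pose w : R := 2 * pi * n.+1%:R.
have w0 : w != 0 by rewrite !mulf_neq0 ?pnatr_eq0// gt_eqF// pi_gt0.
have [sw cw] := sin_2pi_nat n.+1; rewrite -/w in sw cw.
have dw (x : R) : is_derive x 1 (fun t => w * t) w.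
  by have := is_deriveZ w (is_derive_id x 1); rewrite /GRing.scale/= mulr1.
have ds (x : R) : is_derive x 1 (fun t => sin (w * t) / w) (cos (w * x)).
  have d1 : is_derive x 1 (sin \o (fun t => w * t)) (w * cos (w * x)).
    by rewrite mulrC; exact: is_derive1_comp (is_derive_sin _) (dw x).
  have := is_deriveZ w^-1 d1; rewrite /GRing.scale/= mulrA mulVf// mul1r.
  by rewrite (_ : w^-1 \*: _ = (fun t => sin (w * t) / w))//; apply/funext => t; exact: mulrC.
have dc (x : R) : is_derive x 1 (fun t => - cos (w * t) / w) (sin (w * x)).
  have d1 : is_derive x 1 (cos \o (fun t => w * t)) (w * - sin (w * x)).
    by rewrite mulrC; exact: is_derive1_comp (is_derive_cos _) (dw x).
  have := is_deriveZ (- w^-1) d1; rewrite /GRing.scale/= mulNr !mulrN opprK mulrA mulVf// mul1r.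
  rewrite (_ : (- w^-1) \*: _ = (fun t => - cos (w * t) / w))//.
  apply/funext => t; change (- w^-1 * cos (w * t) = - cos (w * t) / w).
  by rewrite mulrC mulrN mulNr.
have cl : continuous (fun t : R => w * t).
  by move=> t; apply: cvgM; [exact: cvg_cst|exact: cvg_id].
have ccos : continuous (fun t : R => cos (w * t)).
  move=> t; apply: (@continuous_comp _ _ _ (fun t => w * t) cos); first exact: cl.
  exact: continuous_cos.
have csin : continuous (fun t : R => sin (w * t)).
  move=> t; apply: (@continuous_comp _ _ _ (fun t => w * t) sin); first exact: cl.
  exact: continuous_sin.
have ftc (F f : R -> R) : (forall x, is_derive x (1 : R) F (f x)) -> continuous f ->
    F 1 = F 0 -> \int[mu]_(t in I01) f t = 0.
  move=> dF cf F01; rewrite /Rintegral (@continuous_FTC2 _ _ F) ?ltr01//.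
  - by rewrite F01 -EFinB subrr.
  - exact: continuous_subspaceT.
  - have cF : continuous F.
      by move=> t; apply: differentiable_continuous; apply/derivable1_diffP; case: (dF t).
    split; first by move=> t _; case: (dF t).
    + exact: cvg_at_right_filter (cF 0).
    + exact: cvg_at_left_filter (cF 1).
  - by move=> t _; rewrite derive1E; case: (dF t).
apply: complexP => /=.
  under eq_Rintegral do rewrite -exprnP zeta_de_moivre/= -/w.
  by apply: (ftc _ _ ds) => //; rewrite mulr1 mulr0 sw sin0.
under eq_Rintegral do rewrite -exprnP zeta_de_moivre/= -/w.
by apply: (ftc _ _ dc) => //; rewrite mulr1 mulr0 cw cos0.
Qed.

End Hardy.

(** * Closed subspaces of L2 *)

Section ClosedSubspace.
Variable R : realType.
Local Notation mu := (@lebesgue_measure R).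
Local Notation I01 := (`[0, 1]%classic : set R).
Local Notation Re := complex.Re.
Local Notation zX n := (fun t : R => zeta t ^ n).
Implicit Types (f g k : R -> R[i]) (a z : R[i]) (N L : set (R -> R[i])).

Lemma closed_subspaceD N f g : closed_subspace N -> N f -> N g -> N (fun t => f t + g t).
Proof.
move=> [_ _ lin _] Nf Ng; have := lin 1 _ _ Nf Ng; congr N.
by apply/funext => t; rewrite mul1r.
Qed.

Lemma closed_subspaceZ N a f : closed_subspace N -> N f -> N (fun t => a * f t).
Proof.
move=> [_ N0 lin _] Nf; have := lin a _ _ Nf N0; congr N.
by apply/funext => t; rewrite addr0.
Qed.

Lemma closed_subspaceB N f g : closed_subspace N -> N f -> N g -> N (fun t => f t - g t).
Proof.
move=> cN Nf Ng; have := closed_subspaceD cN Nf (closed_subspaceZ (-1) cN Ng); congr N.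
by apply/funext => t; rewrite mulN1r.
Qed.

Lemma closed_subspace_aeq N f g : closed_subspace N -> N f -> L2 g -> aeq f g -> N g.
Proof.
move=> cN Nf Lg fg; have Lf := closed_subspace_L2 cN Nf.
apply: (closed_subspace_lim cN (u := fun=> f)) => //.
have -> : norm2 (f \- g) = 0.
  rewrite -(@norm20 R); apply: norm2_aeq; [exact: L2B|exact: L2_cst|].
  by move: fg; apply: ae_imp => t fg It; rewrite /= fg// subrr.
exact: cvg_cst.
Qed.

Lemma closed_setI N L : closed_subspace N -> closed_subspace L ->
  closed_subspace (N `&` L).
Proof.
move=> [N1 N2 N3 N4] [L1 L2' L3 L4]; split.
- by move=> f [/N1].
- by [].
- by move=> a f g [? ?] [? ?]; split; [exact: N3|exact: L3].
- move=> u f H Lf cv; split; [apply: N4 cv|apply: L4 cv] => // n; by have [] := H n.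
Qed.

(** Images such as [zeta L] or [b H2] under a unimodular multiplier are encoded as preimages under
    its conjugate; closedness then follows from boundedness of multiplication. *)
Lemma closed_preimage_mul N f (C : R) : closed_subspace N -> cmeas f -> 0 <= C ->
  {ae mu, forall t, I01 t -> normc (f t) <= C} ->
  closed_subspace [set g | L2 g /\ N (fun t => f t * g t)].
Proof.
move=> cN mf C0 fC; split.
- by move=> g [].
- split; first exact: L2_cst.
  have := closed_subspace0 cN; congr N; apply/funext => t; by rewrite mulr0.
- move=> a g k [Lg Ng] [Lk Nk]; split; first by apply: L2D => //; exact: L2Z.
  have := closed_subspace_lin cN a Ng Nk; congr N; apply/funext => t; ring.
- move=> u g Nu Lg cv; split => //.
  apply: (closed_subspace_lim cN (u := fun n t => f t * u n t)).
  + by move=> n; have [] := Nu n.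
  + exact: L2M_bdd fC Lg.
  have cv' : (fun n => C * norm2 (u n \- g)) @ \oo --> (0 : R).
    by rewrite -(mulr0 C); apply: cvgM => //; exact: cvg_cst.
  apply: (squeeze_cvgr _ (cvg_cst (0 : R)) cv'); apply: nearW => n.
  have Ld : L2 (fun t => u n t - g t) by apply: L2B => //; have [] := Nu n.
  rewrite norm2_ge0/=; apply: norm2_le => //.
    have := L2M_bdd mf fC Ld; congr L2; apply/funext => t /=; ring.
  by move: fC; apply: ae_imp => t fC It; rewrite /= -mulrBr normcM ler_wpM2r ?normc_ge0 ?fC.
Qed.

End ClosedSubspace.

(** * The Hardy space: projections, products and inner functions *)

Section HardySpace.
Variable R : realType.
Local Notation mu := (@lebesgue_measure R).
Local Notation I01 := (`[0, 1]%classic : set R).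
Local Notation Re := complex.Re.
Local Notation zX n := (fun t : R => zeta t ^ n).
Implicit Types (f g k : R -> R[i]) (a z : R[i]) (N L : set (R -> R[i])).

Lemma L2_zetaX (n : int) : L2 (zX n).
Proof.
apply: L2_dom (L2_integrable (L2_cst (1 : R[i]))) _; first exact: cmeas_zetaX.
by apply: aeW => t _; rewrite normc_zetaX normc1.
Qed.

Lemma L2_zetaXM (n : int) f : L2 f -> L2 (fun t => zeta t ^ n * f t).
Proof.
by apply: (@L2M_bdd _ 1); [exact: cmeas_zetaX|apply: aeW => t _; rewrite normc_zetaX].
Qed.

Lemma ip_movel f g k : inner_prod (fun t => f t * g t) k = inner_prod g (fun t => (f t)^* * k t).
Proof. by congr cint; apply/funext => t; rewrite conjcM conjcKE; ring. Qed.

Lemma ip_mover f g k : inner_prod f (fun t => k t * g t) = inner_prod (fun t => (k t)^* * f t) g.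
Proof. by congr cint; apply/funext => t; rewrite conjcM; ring. Qed.

Lemma ip_zetaX f (m n : int) :
  inner_prod (fun t => zeta t ^ m * f t) (zX n) = inner_prod f (zX (n - m)).
Proof.
congr cint; apply/funext => t; rewrite !conj_zetaX opprB expfzDr ?zeta_neq0//.
ring.
Qed.

Lemma zetaX0E : zX 0 = (fun=> 1).
Proof. by apply/funext => t; rewrite expr0z. Qed.

Lemma ip_zetaX_zetaX (m n : int) : m != n -> inner_prod (zX m) (zX n) = 0.
Proof.
have H (j : nat) (m' n' : int) : n' = m' - j.+1%:Z -> inner_prod (zX m') (zX n') = 0.
  move=> ->; rewrite -[RHS](@cint_zetaX R j); congr cint; apply/funext => t.
  by rewrite conj_zetaX -expfzDr ?zeta_neq0// opprB addrC subrK.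
move=> mn; case: (ltgtP m n) mn => // mn _.
  have : 0 < n - m by rewrite subr_gt0.
  case e : (n - m) => [[|j]|//] // _.
  rewrite (ipC (L2_zetaX n) (L2_zetaX m)) (H j) ?conjc0E//.
  by rewrite -e subKr.
have : 0 < m - n by rewrite subr_gt0.
case e : (m - n) => [[|j]|//] // _.
by rewrite (H j)// -e subKr.
Qed.

Lemma L2_ext f : L2 f -> (forall n : int, inner_prod f (zX n) = 0) -> aeq f (fun=> 0).
Proof.
move=> Lf H; apply: fourier_uniqueness.
  have := ip_cintegrable Lf (L2_cst 1); congr cintegrable.
  by apply/funext => t; rewrite conjc1E mulr1.
move=> n; rewrite -[RHS](H (- n)); congr cint; apply/funext => t.
by rewrite conj_zetaX opprK.
Qed.

Lemma H2E : @H2 R = orthogonal_of [set f | exists n : nat, f = zX (- n.+1%:Z)].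
Proof.
apply/seteqP; split=> f [Lf H]; split => //.
  by move=> _ [n ->]; exact: H.
by move=> n; apply: H; exists n.
Qed.

Lemma closed_H2 : closed_subspace (@H2 R).
Proof. by rewrite H2E; apply: closed_orthogonal_of => _ [n ->]; exact: L2_zetaX. Qed.

Lemma H2_L2 f : H2 f -> L2 f. Proof. by case. Qed.

Lemma H2_zetaX (n : nat) : H2 (zX n%:Z).
Proof.
split; first exact: L2_zetaX.
by move=> m; apply: ip_zetaX_zetaX; rewrite -subr_eq0 opprK -PoszD addnS.
Qed.

Lemma H2_cst z : H2 (fun=> z).
Proof.
have := closed_subspaceZ z closed_H2 (H2_zetaX 0); congr H2.
by apply/funext => t; rewrite expr0z mulr1.
Qed.

(* The projection of [k] on [H2] has the Fourier coefficients of [k] at [n >= 0], so it vanishes. *)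
Lemma H2_orthogonal g k : H2 g -> L2 k ->
  (forall n : nat, inner_prod k (zX n%:Z) = 0) -> inner_prod g k = 0.
Proof.
move=> Hg Lk k0; have [p Hp kp] := orthogonal_projection closed_H2 Lk.
have Lp := H2_L2 Hp; have Lg := H2_L2 Hg.
have p0 : aeq p (fun=> 0).
  apply: L2_ext => // -[n|n]; last by have [_] := Hp; exact.
  have := kp _ (H2_zetaX n); rewrite ipBl ?k0 ?sub0r; [|by []|by []|exact: L2_zetaX].
  by move=> /eqP; rewrite oppr_eq0 => /eqP.
rewrite (ipC Lk Lg) (_ : inner_prod k g = 0) ?conjc0E//.
have := kp _ Hg; rewrite ipBl// (ip_aeql Lp (L2_cst 0) Lg p0) ip0l subr0.
exact.
Qed.

Definition bounded_by (C : R) f := {ae mu, forall t, I01 t -> normc (f t) <= C}.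

(** A negative coefficient of [f g] is the inner product of [g] with [conj f] times a negative power
    of [zeta]. That function has no coefficients at [n >= 0], because [f] has none at negative
    indices. *)
Lemma H2M (C : R) f g : bounded_by C f -> H2 f -> H2 g -> H2 (fun t => f t * g t).
Proof.
move=> fC Hf Hg; have Lf := H2_L2 Hf; have Lg := H2_L2 Hg.
split; first by apply: L2M_bdd fC Lg; exact: L2_cmeas.
move=> n; rewrite /fourier_coef ip_movel.
have LfJ : L2 (fun t => (f t)^* * zeta t ^ (- n.+1%:Z)).
  apply: (@L2M_bdd _ C); [exact/cmeasJ/L2_cmeas| |exact: L2_zetaX].
  by move: fC; apply: ae_imp => t fC It; rewrite normcJE fC.
apply: H2_orthogonal => // m.
have -> : inner_prod (fun t => (f t)^* * zeta t ^ (- n.+1%:Z)) (zX m%:Z) =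
    inner_prod (zX (- (m + n).+1%:Z)) f.
  congr cint; apply/funext => t; rewrite conj_zetaX -mulrA -expfzDr ?zeta_neq0//.
  by rewrite mulrC -opprD -PoszD addSn addnC.
have [_ H] := Hf.
by rewrite (ipC Lf (L2_zetaX _)) (_ : inner_prod f _ = 0) ?conjc0E//; exact: H.
Qed.

Lemma bounded_zetaX (n : int) : bounded_by 1 (zX n).
Proof. by apply: aeW => t _; rewrite normc_zetaX. Qed.

Lemma H2_zetaXM (n : nat) f : H2 f -> H2 (fun t => zeta t ^ n%:Z * f t).
Proof. by move=> Hf; have := H2M (bounded_zetaX _) (H2_zetaX n) Hf. Qed.

Lemma mul_zetaE f : mul_zeta f = (fun t => zeta t ^ 1 * f t).
Proof. by apply/funext => t; rewrite expr1z. Qed.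

Lemma H2_mul_zeta f : H2 f -> H2 (mul_zeta f).
Proof. by rewrite mul_zetaE; exact: (@H2_zetaXM 1). Qed.

Lemma ip_mul_zeta1 f : H2 f -> inner_prod (mul_zeta f) (fun=> 1) = 0.
Proof. by move=> [_ H]; rewrite mul_zetaE -zetaX0E ip_zetaX sub0r; exact: (H 0%N). Qed.

Lemma H2_backward f : H2 f -> inner_prod f (fun=> 1) = 0 ->
  H2 (fun t => zeta t ^ (- 1) * f t).
Proof.
move=> [Lf H] f0; split; first exact: L2_zetaXM.
move=> n; rewrite /fourier_coef ip_zetaX opprK.
case: n => [|n].
  by rewrite addrC subrr zetaX0E.
have -> : - n.+2%:Z + 1 = - n.+1%:Z by rewrite -[n.+2]addn1 PoszD opprD subrK.
exact: H.
Qed.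

Lemma cint_ip1 f : cint f = inner_prod f (fun=> 1).
Proof. by congr cint; apply/funext => t; rewrite conjc1E mulr1. Qed.

Lemma disc_val0 f : disc_val f 0 = inner_prod f (fun=> 1).
Proof.
by rewrite -cint_ip1; congr cint; apply/funext => t; rewrite mul0r subr0 divr1.
Qed.

Definition unimodular f := {ae mu, forall t, I01 t -> f t * (f t)^* = 1}.

Lemma inner_unimodular f : inner_function f -> unimodular f.
Proof.
move=> [_]; apply: ae_imp => t H It; rewrite mulcJE.
have /(congr1 (@complex.Re R)) := H It; rewrite normc_def/= => h.
have -> : normc (f t) = 1 by rewrite -h; case: (f t).
by rewrite expr1n.
Qed.

Lemma unimodular_inner f : H2 f -> unimodular f -> inner_function f.
Proof.
move=> Hf uf; split => //; move: uf; apply: ae_imp => t H It.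
rewrite normc_def; have := normc1E (H It); case: (f t) => a b /= ->//.
Qed.

Lemma unimodular_bounded f : unimodular f -> bounded_by 1 f.
Proof. by apply: ae_imp => t H It; rewrite (normc1E (H It)). Qed.

End HardySpace.

Arguments L2_zetaX {R} n.
Arguments H2_zetaX {R} n.
Arguments bounded_zetaX {R} n.
Arguments closed_H2 {R}.

(** * Beurling's theorem *)

Section Beurling.
Variable R : realType.
Local Notation mu := (@lebesgue_measure R).
Local Notation I01 := (`[0, 1]%classic : set R).
Local Notation Re := complex.Re.
Local Notation zX n := (fun t : R => zeta t ^ n).
Implicit Types (f g k : R -> R[i]) (a z : R[i]) (N L : set (R -> R[i])).

Lemma L2_unimodularM f g : cmeas f -> unimodular f -> L2 g -> L2 (fun t => f t * g t).
Proof. by move=> mf uf; apply: (L2M_bdd mf (unimodular_bounded uf)). Qed.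

Lemma unimodularJ f : unimodular f -> unimodular (fun t => (f t)^*).
Proof. by apply: ae_imp => t H It; rewrite conjcKE mulrC H. Qed.

Lemma unimodularMJK f g : unimodular f -> aeq (fun t => f t * ((f t)^* * g t)) g.
Proof. by apply: ae_imp => t H It; rewrite mulrA H// mul1r. Qed.

Lemma unimodularJMK f g : unimodular f -> aeq (fun t => (f t)^* * (f t * g t)) g.
Proof. by apply: ae_imp => t H It; rewrite mulrA [_^* * _]mulrC H// mul1r. Qed.

Lemma aeqB0 f g : aeq (fun t => f t - g t) (fun=> 0) -> aeq f g.
Proof. by apply: ae_imp => t H It; apply/eqP; rewrite -subr_eq0 H. Qed.

Lemma zetaXK (n : int) f : (fun t : R => zeta t ^ n * (zeta t ^ (- n) * f t)) = f.
Proof. by apply/funext => t; rewrite mulrA -expfzDr ?zeta_neq0// subrr expr0z mul1r. Qed.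

(* The wandering subspace [L (-) zeta L] is nonzero; a unit vector [phi] in it is
   orthogonal to all [zeta^n phi], so that [|phi|^2] has the Fourier coefficients of 1. *)
Theorem beurling L f0 : closed_subspace L -> L `<=` @H2 R ->
  (forall f, L f -> L (mul_zeta f)) -> L f0 -> ~ aeq f0 (fun=> 0) ->
  exists phi, [/\ inner_function phi, L phi & L = mul_set phi (@H2 R)].
Proof.
move=> cL LH Lz Lf0 f0n.
have LL := closed_subspace_L2 cL.
(* [W] is [zeta L], in the preimage form that makes its closedness immediate. *)
pose W := [set f : R -> R[i] | L2 f /\ L (fun t => zeta t ^ (- 1) * f t)].
have cW : closed_subspace W.
  apply: (@closed_preimage_mul _ _ (zX (- 1)) 1) => //; first exact: cmeas_zetaX.
  exact: bounded_zetaX.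
have LzX (n : nat) f : L f -> L (fun t => zeta t ^ n%:Z * f t).
  move=> Lf; elim: n => [|n IH].
    by move: Lf; congr L; apply/funext => t; rewrite expr0z mul1r.
  have := Lz _ IH; congr L; apply/funext => t.
  by rewrite /mul_zeta mulrA -exprSz.
have WL : W `<=` L.
  by move=> f [Lf /Lz]; rewrite mul_zetaE (zetaXK 1).
have WzX (n : nat) f : L f -> W (fun t => zeta t ^ n.+1%:Z * f t).
  move=> Lf; split; first exact/L2_zetaXM/LL.
  have := LzX n _ Lf; congr L; apply/funext => t.
  by rewrite mulrA -expfzDr ?zeta_neq0// -[n.+1]addn1 PoszD addrC addrK.
(* If [zeta L] were all of [L], every [zeta^-k f0] would lie in [L], hence in H2. Writing an index
   as [k - (p + 1)] makes the coefficient of [f0] there a negative coefficient of [zeta^-k f0], so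
   all of them vanish. *)
have [f [Lf fW]] : exists f, L f /\ ~ W f.
  apply: contrapT => /forallNP H; apply: f0n.
  have LW f : L f -> L (fun t => zeta t ^ (- 1) * f t).
    by move=> Lf; have /not_andP[//|/contrapT[]] := H f.
  have LXN (n : nat) : L (fun t => zeta t ^ (- n%:Z) * f0 t).
    elim: n => [|n IH]; first by move: Lf0; congr L; apply/funext => t; rewrite oppr0 expr0z mul1r.
    have := LW _ IH; congr L; apply/funext => t.
    by rewrite mulrA -expfzDr ?zeta_neq0// -opprD -PoszD.
  apply: L2_ext => [|m]; first exact: LL.
  have [k [p ->]] : exists k p : nat, m = k%:Z - p.+1%:Z.
    case: m => n; first by exists n.+1, 0%N; rewrite -[n.+1]addn1 PoszD addrK.
    by exists 0%N, n; rewrite NegzE sub0r.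
  have [_ /(_ p)] := LH _ (LXN k); rewrite /fourier_coef ip_zetaX opprK addrC.
  exact.
have LLf := LL _ Lf.
have [p Wp fp] := orthogonal_projection cW LLf.
have Lp := WL _ Wp.
pose g t := f t - p t.
have Lg : L g by exact: closed_subspaceB.
have LLg := LL _ Lg.
have g0 : norm2 g != 0.
  apply/eqP => /(norm2_eq0 LLg) /aeqB0 fpe; apply: fW.
  by apply: (closed_subspace_aeq cW Wp LLf); exact: aeq_sym.
pose phi t := ((norm2 g)^-1)%:C * g t.
have Lphi : L phi by exact: closed_subspaceZ.
have LLphi := LL _ Lphi.
have mphi : cmeas phi by exact: L2_cmeas.
have phiW k : W k -> inner_prod phi k = 0.
  by move=> Wk; rewrite ipZl ?fp ?mulr0//; exact: (closed_subspace_L2 cW).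
have phi1 : inner_prod phi phi = 1.
  rewrite ip_norm2 norm2Z// normc_sqr/= expr0n/= addr0 exprVn mulVf ?expf_neq0//.
have uphi : unimodular phi.
  pose q t := phi t * (phi t)^* - 1.
  have iq : cintegrable q.
    by apply: cintegrableD; [exact: ip_cintegrable|exact: cintegrable_cst].
  have iqz (n : int) : cintegrable (fun t => phi t * (phi t)^* * zeta t ^ n).
    have := ip_cintegrable (L2_zetaXM n LLphi) LLphi; congr cintegrable.
    by apply/funext => t; ring.
  have i1z (n : int) : cintegrable (zX n).
    have := ip_cintegrable (L2_zetaX n) (L2_cst (1 : R[i])); congr cintegrable.
    by apply/funext => t; rewrite conjc1E mulr1.
  have q0 (n : int) : cint (fun t => q t * zeta t ^ n) =
      inner_prod (fun t => zeta t ^ n * phi t) phi - inner_prod (zX n) (zX 0).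
    have -> : (fun t => q t * zeta t ^ n) =
        (fun t => phi t * (phi t)^* * zeta t ^ n + (-1) * zeta t ^ n).
      by apply/funext => t; rewrite /q; ring.
    rewrite cintD ?cintZ ?mulN1r//; last exact: cintegrableZ.
    congr (_ - _); congr cint; apply/funext => t; first by ring.
    by rewrite expr0z conjc1E mulr1.
  have ort (n : nat) : inner_prod phi (fun t => zeta t ^ n.+1%:Z * phi t) = 0.
    by apply: phiW; exact: WzX.
  have zn (n : int) : n != 0 -> inner_prod (zX n) (zX 0) = 0 by exact: ip_zetaX_zetaX.
  have : aeq q (fun=> 0).
    apply: fourier_uniqueness => // -[[|n]|n]; rewrite q0.
    - rewrite zetaX0E -cint_ip1 cint_cst.
      rewrite (_ : (fun t => _ * phi t) = phi) ?phi1 ?subrr//.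
      by apply/funext => t; rewrite expr0z mul1r.
    - rewrite zn// (ipC LLphi (L2_zetaXM _ LLphi)) ort conjc0E subr0//.
    - rewrite zn// subr0 -[RHS](ort n); congr cint; apply/funext => t.
      by rewrite [in RHS]conjcM conj_zetaX NegzE; ring.
  by apply: ae_imp => t H It; apply/eqP; rewrite -subr_eq0; apply/eqP; exact: H.
exists phi; split => //; first by apply: unimodular_inner => //; exact: LH.
apply/seteqP; split => x.
  move=> Lx; have LLx := LL _ Lx; split => //.
  have Ly : L2 (fun t => (phi t)^* * x t).
    by apply: L2_unimodularM => //; [exact: cmeasJ|exact: unimodularJ].
  exists (fun t => (phi t)^* * x t); last by apply: aeq_sym; exact: unimodularMJK.
  (* The negative coefficients of [conj phi x] are the products [<zeta^(n+1) x, phi>], which vanish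
     because [phi] is orthogonal to [W]. *)
  split => // n; rewrite /fourier_coef ip_movel.
  have -> : inner_prod x (fun t => ((phi t)^*)^* * zeta t ^ (- n.+1%:Z)) =
      inner_prod (fun t => zeta t ^ n.+1%:Z * x t) phi.
    congr cint; apply/funext => t; rewrite conjcKE conjcM conj_zetaX opprK; ring.
  have Wx := WzX n _ Lx; have LWx := closed_subspace_L2 cW Wx.
  by rewrite (ipC LLphi LWx) phiW// conjc0E.
move=> [LLx [y Hy xy]]; have LLy := H2_L2 Hy.
pose w t := phi t * y t.
have Lw : L2 w by exact: L2_unimodularM.
apply: closed_subspace_aeq LLx (aeq_sym xy) => //.
(* That [phi y] lies in [L] is shown without approximating [y] by polynomials: the component [d] of
   [w] orthogonal to [L] is orthogonal to all [zeta^n phi], so [conj phi d] has no coefficients at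
   [n >= 0] and is orthogonal to [y]. Hence [<w, d> = 0], and then [d = 0]. *)
have [r Lr wr] := orthogonal_projection cL Lw.
have LLr := LL _ Lr.
pose d t := w t - r t.
have Ld : L2 d by exact: L2B.
have Lpd : L2 (fun t => (phi t)^* * d t).
  by apply: L2_unimodularM => //; [exact: cmeasJ|exact: unimodularJ].
have wd : inner_prod w d = 0.
  rewrite ip_movel; apply: H2_orthogonal => // n.
  rewrite ip_movel; rewrite -[RHS](wr _ (LzX n _ Lphi)); congr inner_prod.
  by apply/funext => t; rewrite conjcKE mulrC.
have rd : inner_prod r d = 0 by rewrite (ipC Ld LLr) wr// conjc0E.
have /(aeq_ip0 Ld) dz : inner_prod d d = 0 by rewrite ipBl// wd rd subr0.
exact: closed_subspace_aeq cL Lr Lw (aeq_sym (aeqB0 dz)).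
Qed.

End Beurling.

(** * Model spaces *)

Section ModelSpace.
Variable R : realType.
Local Notation mu := (@lebesgue_measure R).
Local Notation I01 := (`[0, 1]%classic : set R).
Local Notation Re := complex.Re.
Local Notation Im := complex.Im.
Local Notation zX n := (fun t : R => zeta t ^ n).
Implicit Types (f g k theta : R -> R[i]) (a z v : R[i]) (N L M : set (R -> R[i])).

Lemma inner_H2 theta : inner_function theta -> H2 theta. Proof. by case. Qed.

Lemma inner_H2M theta f : inner_function theta -> H2 f -> H2 (fun t => theta t * f t).
Proof.
move=> it Hf; apply: H2M (inner_H2 it) Hf.
exact/unimodular_bounded/inner_unimodular.
Qed.

Lemma inner_L2M theta f : inner_function theta -> L2 f -> L2 (fun t => theta t * f t).
Proof.
move=> it; apply: L2_unimodularM; first exact/L2_cmeas/H2_L2/inner_H2.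
exact: inner_unimodular.
Qed.

Lemma inner_L2JM theta f : inner_function theta -> L2 f -> L2 (fun t => (theta t)^* * f t).
Proof.
move=> it; apply: L2_unimodularM; first exact/cmeasJ/L2_cmeas/H2_L2/inner_H2.
exact/unimodularJ/inner_unimodular.
Qed.

Lemma ip_inner theta f g : inner_function theta -> L2 f -> L2 g ->
  inner_prod (fun t => theta t * f t) (fun t => theta t * g t) = inner_prod f g.
Proof.
move=> it Lf Lg; rewrite ip_mover; apply: ip_aeql => //.
  by apply: inner_L2JM => //; exact: inner_L2M.
exact/unimodularJMK/inner_unimodular.
Qed.

Lemma model_spaceP theta f : inner_function theta -> model_space theta f <->
  H2 f /\ forall y, H2 y -> inner_prod f (fun t => theta t * y t) = 0.
Proof.
move=> it; split=> -[Hf H]; split => //.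
  move=> y Hy; apply: H; split; first exact/H2_L2/inner_H2M.
  by exists y => //; exact: aeq_refl.
move=> k [Lk [y Hy ky]]; rewrite -[RHS](H y Hy).
by apply: ip_aeqr ky => //; [exact/H2_L2/inner_H2M|exact: H2_L2].
Qed.

Lemma closed_model_space theta : closed_subspace (model_space theta).
Proof.
have -> : model_space theta = (@H2 R) `&` orthogonal_of (mul_set theta (@H2 R)).
  apply/seteqP; split=> f [Hf H].
    by split => //; split => //; exact: H2_L2.
  by split => //; have [] := H.
by apply: closed_setI; [exact: closed_H2|apply: closed_orthogonal_of => f []].
Qed.

(** When [f(0) = 0], all frequencies of [conj f] are strictly negative. *)
Lemma H2_conj_orthogonal f g : H2 f -> inner_prod f (fun=> 1) = 0 -> H2 g ->
  inner_prod g (fun t => (f t)^*) = 0.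
Proof.
move=> Hf f1 Hg; have Lf := H2_L2 Hf.
apply: H2_orthogonal => //; first exact: L2J.
move=> n; have -> : inner_prod (fun t => (f t)^*) (zX n%:Z) = (inner_prod f (zX (- n%:Z)))^*.
  rewrite -ipC//; last exact: L2_zetaX.
  by congr cint; apply/funext => t; rewrite conj_zetaX mulrC.
case: n => [|n]; first by rewrite oppr0 zetaX0E f1 conjc0E.
by have [_ H] := Hf; rewrite (_ : inner_prod f _ = 0) ?conjc0E//; exact: H.
Qed.

Lemma model_space_cst1 theta : inner_function theta ->
  inner_prod theta (fun=> 1) = 0 -> model_space theta (fun=> 1).
Proof.
move=> it t0; apply/model_spaceP => //; split; first exact: H2_cst.
move=> y Hy; have Lty := H2_L2 (inner_H2M it Hy).
rewrite (ipC Lty (L2_cst 1)) (_ : inner_prod _ _ = 0) ?conjc0E//.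
rewrite -[RHS](H2_conj_orthogonal (inner_H2 it) t0 Hy) ip_movel.
by congr inner_prod; apply/funext => t; rewrite mulr1.
Qed.

(** With [y = y0 + zeta y'], the part [zeta y'] contributes [<f, theta y'> = 0] to
    [<zeta f, theta y>], so only [conj(y0) c] remains; [c theta] has the same product with
    [theta y]. *)
Lemma model_space_shift theta f : inner_function theta -> model_space theta f ->
  model_space theta (fun t => mul_zeta f t - inner_prod (mul_zeta f) theta * theta t).
Proof.
move=> it Kf; have [Hf fo] := (model_spaceP _ it).1 Kf.
set c := inner_prod _ _; have Hzf := H2_mul_zeta Hf; have Ht := inner_H2 it.
apply/model_spaceP => //; split.
  exact: closed_subspaceB closed_H2 Hzf (closed_subspaceZ c closed_H2 Ht).
move=> y Hy; pose y0 := inner_prod y (fun=> 1).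
have Lzf := H2_L2 Hzf; have Lt := H2_L2 Ht; have Ly := H2_L2 Hy.
have Lty := H2_L2 (inner_H2M it Hy).
have Hy1 : H2 (fun t => y t - y0) by apply: closed_subspaceB closed_H2 Hy (H2_cst y0).
have y10 : inner_prod (fun t => y t - y0) (fun=> 1) = 0.
  rewrite ipBl//; [|exact: L2_cst|exact: L2_cst].
  by rewrite -[inner_prod (fun=> y0) _]cint_ip1 cint_cst subrr.
have Hy' := H2_backward Hy1 y10; set y' := (fun t => zeta t ^ (-1) * _) in Hy'.
have yE t : y t = y0 + zeta t * y' t.
  by rewrite /y' exprN1 mulrA divff ?zeta_neq0// mul1r addrC subrK.
have Lty' := H2_L2 (inner_H2M it Hy').
have Lzty' := H2_L2 (H2_mul_zeta (inner_H2M it Hy')).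
rewrite ipBl//; last exact: L2Z.
have -> : inner_prod (mul_zeta f) (fun t => theta t * y t) = y0^* * c.
  have -> : (fun t => theta t * y t) =
      (fun t => y0 * theta t + mul_zeta (fun t => theta t * y' t) t).
    by apply/funext => t; rewrite yE /mul_zeta; ring.
  rewrite ipDr ?ipZr//; last exact: L2Z.
  rewrite -/c (_ : inner_prod _ (mul_zeta _) = 0) ?addr0//.
  rewrite -[RHS](fo _ Hy'); congr cint; apply/funext => t.
  by rewrite /mul_zeta conjcM; have := zetaMJ t; set z := zeta t => e;
     rewrite -[RHS]mul1r -e; ring.
rewrite ipZl//.
have -> : inner_prod theta (fun t => theta t * y t) = y0^*.
  have := ip_inner it (L2_cst (1 : R[i])) Ly; rewrite (ipC Ly (L2_cst 1)) -/y0 => <-.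
  by congr inner_prod; apply/funext => t; rewrite mulr1.
by rewrite mulrC subrr.
Qed.

(* The conjugation f |-> conj(zeta) theta conj(f) of K_theta. *)
Lemma model_space_conj theta g : inner_function theta -> model_space theta g ->
  model_space theta (fun t => zeta t ^ (- 1) * (theta t * (g t)^*)).
Proof.
move=> it Kg; have [Hg go] := (model_spaceP _ it).1 Kg; have Lg := H2_L2 Hg.
have Lk : L2 (fun t => zeta t ^ (- 1) * (theta t * (g t)^*)).
  by apply: L2_zetaXM; apply: inner_L2M => //; exact: L2J.
apply/model_spaceP => //; split.
  split => // n; rewrite /fourier_coef.
  have Hz := H2_zetaX (R := R) n; have Ltz := H2_L2 (inner_H2M it Hz).
  have -> : inner_prod (fun t => zeta t ^ (- 1) * (theta t * (g t)^*)) (zX (- n.+1%:Z)) =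
      (inner_prod g (fun t => theta t * zeta t ^ n%:Z))^*.
    rewrite -ipC//; congr cint; apply/funext => t.
    rewrite conj_zetaX opprK -[n.+1]addn1 PoszD expfzDr ?zeta_neq0//.
    rewrite exprN1 expr1z; have := zeta_neq0 t; set z := zeta t => z0.
    by field.
  by rewrite go// conjc0E.
move=> y Hy; have Ly := H2_L2 Hy.
have Hzg := H2_mul_zeta Hg.
have Lzg := H2_L2 Hzg.
have -> : inner_prod (fun t => zeta t ^ (- 1) * (theta t * (g t)^*)) (fun t => theta t * y t) =
    (inner_prod y (fun t => (mul_zeta g t)^*))^*.
  rewrite -ipC//; last exact: L2J.
  have L1 : L2 (fun t => zeta t ^ (- 1) * (g t)^*) by apply: L2_zetaXM; exact: L2J.
  transitivity (inner_prod (fun t => zeta t ^ (- 1) * (g t)^*) y).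
    rewrite -(ip_inner it L1 Ly); congr cint; apply/funext => t; ring.
  by congr cint; apply/funext => t; rewrite /mul_zeta conjcM exprN1 zetaV.
by rewrite (H2_conj_orthogonal Hzg (ip_mul_zeta1 Hg) Hy) conjc0E.
Qed.

End ModelSpace.

(** * Nearly invariant subspaces *)

Section Hitt.
Variable R : realType.
Local Notation mu := (@lebesgue_measure R).
Local Notation I01 := (`[0, 1]%classic : set R).
Local Notation Re := complex.Re.
Local Notation Im := complex.Im.
Local Notation zX n := (fun t : R => zeta t ^ n).
Implicit Types (f g k theta : R -> R[i]) (a z v : R[i]) (N L M : set (R -> R[i])).

Lemma hitt_closed M h theta : hitt M h theta -> closed_subspace M.
Proof. by case=> -[]. Qed.

Lemma hitt_H2 M h theta : hitt M h theta -> M `<=` @H2 R.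
Proof. by case=> -[]. Qed.

Lemma hitt_theta_mean0 M h theta : hitt M h theta ->
  inner_prod theta (fun=> 1) = 0.
Proof. by move=> H; rewrite -disc_val0 (hitt_theta0 H). Qed.

Lemma hitt_mul M h theta k : hitt M h theta -> model_space theta k ->
  M (fun t => h t * k t).
Proof. by move=> H Kk; have [] := hitt_isometry H Kk. Qed.

(** Polarization: the norm of [f - g] determines the real part, and the imaginary part is the real
    part for ['i * g], which stays in [K_theta]. *)
Lemma hitt_ip M h theta f g : hitt M h theta ->
  model_space theta f -> model_space theta g ->
  inner_prod (fun t => h t * f t) (fun t => h t * g t) = inner_prod f g.
Proof.
move=> H Kf Kg; have cK := closed_model_space theta; have cM := hitt_closed H.
have LK k : model_space theta k -> L2 k by exact: closed_subspace_L2.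
have LM k : model_space theta k -> L2 (fun t => h t * k t).
  by move=> Kk; apply: (closed_subspace_L2 cM); exact: hitt_mul Kk.
have nE k : model_space theta k -> norm2 (fun t => h t * k t) = norm2 k.
  by move=> Kk; have [_] := hitt_isometry H Kk.
have re k l : model_space theta k -> model_space theta l ->
    Re (inner_prod (fun t => h t * k t) (fun t => h t * l t)) = Re (inner_prod k l).
  move=> Kk Kl; have := norm2_sub_sqr (LM _ Kk) (LM _ Kl).
  have -> : (fun t => h t * k t - h t * l t) = (fun t => h t * (k t - l t)).
    by apply/funext => t; rewrite mulrBr.
  rewrite !nE//; last exact: closed_subspaceB.
  rewrite norm2_sub_sqr; [|exact: LK|exact: LK]; lra.
apply: complexP; first exact: re.
have Kig : model_space theta (fun t => 'i * g t) by exact: closed_subspaceZ.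
have imE k l : L2 k -> L2 l -> Im (inner_prod k l) = Re (inner_prod k (fun t => 'i * l t)).
  move=> Lk Ll; rewrite ipZr//; case: (inner_prod k l) => a b.
  by rewrite ReM/=; ring.
rewrite imE; [|exact: LM|exact: LM]; rewrite imE; [|exact: LK|exact: LK].
rewrite -(re f _ Kf Kig); congr (Re _); congr inner_prod; apply/funext => t; ring.
Qed.

Lemma hitt_model_cst1 M h theta : hitt M h theta -> model_space theta (fun=> 1).
Proof.
by move=> H; apply: model_space_cst1 (hitt_inner H) (hitt_theta_mean0 H).
Qed.

(** [theta] is outside [K_theta], so the isometry does not apply to [h theta]. With
    [k = conj(zeta) theta conj(g)] in [K_theta], one has [theta conj(g) = zeta k = s + c theta] with
    [s] in [K_theta]. The product is therefore [<h s, h> + c <h theta, h> = <s, 1> + c v], where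
    [<s, 1> = 0] and [c] is the conjugate of [<g, 1>]. *)
Lemma hitt_ip_theta M h theta v g : hitt M h theta ->
  v = cint (fun t => theta t * `|h t| ^+ 2) -> model_space theta g ->
  inner_prod (fun t => h t * theta t) (fun t => h t * g t) = v * (inner_prod g (fun=> 1))^*.
Proof.
move=> H vE Kg; have it := hitt_inner H; have cK := closed_model_space theta.
have K1 := hitt_model_cst1 H; have Hg : H2 g by case: Kg.
have Lg := H2_L2 Hg.
have Hh : H2 h by apply: (hitt_H2 H); exact: hitt_mem H.
have Lh := H2_L2 Hh; have Lt := H2_L2 (inner_H2 it).
have Kk := model_space_conj it Kg; set k := (fun t => _) in Kk.
have Hk : H2 k by case: Kk.
have Ks := model_space_shift it Kk; set c := inner_prod _ _ in Ks.
set s := (fun t => _) in Ks.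
have Lht : L2 (fun t => h t * theta t).
  by have := inner_L2M it Lh; congr L2; apply/funext => t; rewrite mulrC.
have Lhs : L2 (fun t => h t * s t).
  by apply: (closed_subspace_L2 (hitt_closed H)); exact: hitt_mul Ks.
have zk t : zeta t * k t = theta t * (g t)^*.
  by rewrite /k exprN1 mulrA divff ?zeta_neq0// mul1r.
have cE : c = (inner_prod g (fun=> 1))^*.
  rewrite -(ipC Lg (L2_cst 1)) -(ip_inner it (L2_cst 1) Lg).
  rewrite /c.
  have -> : mul_zeta k = (fun t => theta t * (g t)^*) by apply/funext => t; exact: zk.
  have -> : inner_prod (fun t => theta t * (g t)^*) theta =
      inner_prod (fun t => theta t * (g t)^*) (fun t => theta t * 1).
    by congr inner_prod; apply/funext => t; rewrite mulr1.
  rewrite ip_inner//; [|exact: L2J|exact: L2_cst].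
  rewrite ip_inner//; last exact: L2_cst.
  by congr cint; apply/funext => t; rewrite conjc1E mulr1 mul1r.
have -> : inner_prod (fun t => h t * theta t) (fun t => h t * g t) =
    inner_prod (fun t => h t * s t + c * (h t * theta t)) (fun t => h t * 1).
  congr cint; apply/funext => t.
  have -> : h t * s t + c * (h t * theta t) = h t * (zeta t * k t).
    by rewrite /s /mul_zeta; ring.
  by rewrite zk !conjcM conjc1E; ring.
have Lh1 : L2 (fun t => h t * 1).
  by move: Lh; congr L2; apply/funext => t; rewrite mulr1.
rewrite ipDl ?ipZl//; last exact: L2Z.
rewrite (hitt_ip H Ks K1) ipBl//; [|exact/H2_L2/H2_mul_zeta|exact: L2Z|exact: L2_cst].
rewrite ipZl//; last exact: L2_cst.
rewrite (hitt_theta_mean0 H) mulr0 subr0 (ip_mul_zeta1 Hk) add0r cE mulrC.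
congr (_ * _); rewrite vE; congr cint; apply/funext => t.
by rewrite mulr1 sqr_normc; ring.
Qed.

(** In other words, the projection of [h theta] on [M] is [v h]: the isometry gives
    [<h, h g> = <1, g>], so [v h] has the products computed in [hitt_ip_theta]. *)
Lemma hitt_ip_theta_sub M h theta v g : hitt M h theta ->
  v = cint (fun t => theta t * `|h t| ^+ 2) -> model_space theta g ->
  inner_prod (fun t => h t * (theta t - v)) (fun t => h t * g t) = 0.
Proof.
move=> H vE Kg; have it := hitt_inner H.
have K1 := hitt_model_cst1 H; have Lg : L2 g by case: Kg => /H2_L2.
have Lh : L2 h by apply/H2_L2/(hitt_H2 H); exact: hitt_mem H.
have Lht : L2 (fun t => h t * theta t).
  by have := inner_L2M it Lh; congr L2; apply/funext => t; rewrite mulrC.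
have Lhg : L2 (fun t => h t * g t).
  by apply: (closed_subspace_L2 (hitt_closed H)); exact: hitt_mul Kg.
have -> : (fun t => h t * (theta t - v)) = (fun t => h t * theta t - v * (h t * 1)).
  by apply/funext => t; ring.
have Lh1 : L2 (fun t => h t * 1).
  by move: Lh; congr L2; apply/funext => t; rewrite mulr1.
rewrite ipBl ?ipZl//; last exact: L2Z.
by rewrite (hitt_ip_theta H vE Kg) (hitt_ip H K1 Kg) -(ipC Lg (L2_cst 1)) subrr.
Qed.

(* If [|v| = 1] then [h theta = v h]; but [h theta] is [zeta] times an element of [M],
   so its value at [0] is [0], whereas [h(0) > 0]. *)
Lemma hitt_v_lt1 M h theta v : hitt M h theta ->
  v = cint (fun t => theta t * `|h t| ^+ 2) -> normc v < 1.
Proof.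
move=> H vE; have it := hitt_inner H; have K1 := hitt_model_cst1 H.
have Hh : H2 h by apply: (hitt_H2 H); exact: hitt_mem H.
have Lh := H2_L2 Hh.
have Lht : L2 (fun t => h t * theta t).
  by have := inner_L2M it Lh; congr L2; apply/funext => t; rewrite mulrC.
have Kk := model_space_conj it K1; set k := (fun t => _) in Kk.
have Hhk : H2 (fun t => h t * k t) by apply: (hitt_H2 H); exact: hitt_mul Kk.
have ht0 : inner_prod (fun t => h t * theta t) (fun=> 1) = 0.
  rewrite -[RHS](ip_mul_zeta1 Hhk); congr inner_prod; apply/funext => t.
  rewrite /mul_zeta /k conjc1E exprN1; have := zeta_neq0 t; set z := zeta t => z0.
  by field.
have hm : inner_prod h (fun=> 1) != 0.
  by rewrite -disc_val0 gt_eqF//; exact: hitt_gt0 H.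
rewrite ltNge; apply/negP => v1.
have v0 : v != 0 by apply/eqP => e; move: v1; rewrite e normc0 ler10.
have hh : inner_prod (fun t => h t * theta t) h = v.
  rewrite vE; congr cint; apply/funext => t; rewrite sqr_normc; ring.
have nht : norm2 (fun t => h t * theta t) = 1.
  rewrite -(hitt_norm H); apply: norm2_aeq => //.
  by move: (inner_unimodular it); apply: ae_imp => t ut It; rewrite normcM (normc1E (ut It)) mulr1.
(* The square of this norm is [1 + |v|^2 - 2 |v|^2 = 1 - |v|^2], which is at most 0 under the
   assumption [v1]. *)
have e0 : norm2 (fun t => h t * theta t - v * h t) = 0.
  apply/eqP; rewrite -sqrf_eq0 eq_le sqr_ge0 andbT.
  rewrite norm2_sub_sqr//; last exact: L2Z.
  rewrite norm2Z// ipZr// hh nht (hitt_norm H).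
  rewrite (_ : v^* * v = (normc v ^+ 2)%:C); last by rewrite mulrC mulcJE.
  have : 1 <= normc v ^+ 2 by rewrite exprn_ege1.
  by rewrite /=; lra.
have Lvh : L2 (fun t => v * h t) by exact: L2Z.
have e := aeqB0 (norm2_eq0 (L2B Lht Lvh) e0).
have := ht0; rewrite (ip_aeql Lht Lvh (L2_cst 1) e) ipZl//; last exact: L2_cst.
by move=> /eqP; rewrite mulf_eq0 (negbTE v0) (negbTE hm).
Qed.

(* [A_z^M (h f0) = h (S_theta f0 + v <f0, S^* theta> 1)], a rank one perturbation of the
   compressed shift [S_theta f0 = zeta f0 - <zeta f0, theta> theta] of [K_theta]. *)
Lemma compressed_shift_model M h theta v N f f0 : hitt M h theta ->
  v = cint (fun t => theta t * `|h t| ^+ 2) ->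
  closed_subspace N -> N `<=` M -> (forall k, N k -> N (compressed_shift M k)) ->
  N f -> model_space theta f0 -> aeq f (fun t => h t * f0 t) ->
  N (fun t => h t * (mul_zeta f0 t - inner_prod (mul_zeta f0) theta * (theta t - v))).
Proof.
move=> H vE cN NM NA Nf Kf0 ff0; have it := hitt_inner H; have K1 := hitt_model_cst1 H.
have cM := hitt_closed H; have LM := closed_subspace_L2 cM.
set c := inner_prod _ _.
pose f1 t := mul_zeta f0 t - c * (theta t - v).
have Kf1 : model_space theta f1.
  have := closed_subspaceD (closed_model_space theta) (model_space_shift it Kf0)
    (closed_subspaceZ (c * v) (closed_model_space theta) K1).
  by congr model_space; apply/funext => t; rewrite /f1 -/c; ring.
pose q t := h t * f1 t.
have Mq : M q by exact: hitt_mul Kf1.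
have Lf := LM _ (NM _ Nf).
have Lzf : L2 (mul_zeta f) by rewrite mul_zetaE; exact: L2_zetaXM.
have Lh : L2 h by apply/H2_L2/(hitt_H2 H); exact: hitt_mem H.
have Lhf0 : L2 (fun t => h t * f0 t) by apply: LM; exact: hitt_mul Kf0.
have Lhtv : L2 (fun t => h t * (theta t - v)).
  have := L2B (inner_L2M it Lh) (L2Z v Lh); congr L2; apply/funext => t; ring.
have qo k : M k -> inner_prod (mul_zeta f \- q) k = 0.
  move=> Mk; have Lk := LM _ Mk.
  have [_ [g Kg kg]] : mul_set h (model_space theta) k by rewrite -(hitt_onto H).
  have Lhg : L2 (fun t => h t * g t) by apply: LM; exact: hitt_mul Kg.
  have Lq := LM _ Mq.
  rewrite (ip_aeqr Lk Lhg _ kg); last exact: L2B.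
  have L3 : L2 (fun t => c * (h t * (theta t - v))) by exact: L2Z.
  rewrite (@ip_aeql _ _ (fun t => c * (h t * (theta t - v)))) //; last first.
  - move: ff0; apply: ae_imp => t e It; rewrite /= /mul_zeta e// /q /f1 /mul_zeta; ring.
  - exact: L2B.
  by rewrite ipZl// (hitt_ip_theta_sub H vE Kg) mulr0.
have NAf := NA _ Nf.
(* [orth_proj] selects some function with the projection property, and [q] witnesses that one
   exists. The two differ by an element of [M] orthogonal to [M], so they agree almost everywhere,
   which is all that a closed subspace [N] requires. *)
have : [set g | M g /\ forall k, M k -> inner_prod (mul_zeta f \- g) k = 0]
    (compressed_shift M f).
  by rewrite /compressed_shift /orth_proj; apply: xgetPex; exists q.
move=> /= [MA Ao]; have LA := LM _ MA; have Lq := LM _ Mq.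
have Md : M (fun t => compressed_shift M f t - q t) by exact: closed_subspaceB.
have Ld := LM _ Md.
apply: (closed_subspace_aeq cN NAf Lq); apply: aeqB0; apply: aeq_ip0 => //.
have e : (fun t => compressed_shift M f t - q t) =
    (fun t => (mul_zeta f \- q) t - (mul_zeta f \- compressed_shift M f) t).
  by apply/funext => t /=; ring.
rewrite {1}e ipBl ?qo ?Ao ?subrr//; exact: L2B.
Qed.

End Hitt.

(** * Frostman shifts *)

Section Frostman.
Variable R : realType.
Local Notation mu := (@lebesgue_measure R).
Local Notation I01 := (`[0, 1]%classic : set R).
Local Notation Re := complex.Re.
Local Notation zX n := (fun t : R => zeta t ^ n).
Implicit Types (f g k theta : R -> R[i]) (a z v : R[i]) (N L M : set (R -> R[i])).

Definition frostman_den v theta : R -> R[i] := fun t => 1 - v^* * theta t.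
Local Notation den := frostman_den.

Lemma frostman_den_ge v z : normc v < 1 -> z * z^* = 1 ->
  1 - normc v <= normc (1 - v^* * z).
Proof.
move=> v1 uz; rewrite lerBlDr.
have <- : normc (v^* * z) = normc v by rewrite normcM normcJE (normc1E uz) mulr1.
by rewrite -[leLHS](@normc1 R) -{1}(subrK (v^* * z) 1); exact: le_normcD.
Qed.

Lemma frostman_den_neq0 v z : normc v < 1 -> z * z^* = 1 -> 1 - v^* * z != 0.
Proof.
move=> v1 uz; apply/eqP => d0; have := frostman_den_ge v1 uz.
by rewrite d0 normc0 subr_le0 leNgt v1.
Qed.

Lemma H2_frostman_den v theta : H2 theta -> H2 (den v theta).
Proof.
move=> Ht.
exact: closed_subspaceB closed_H2 (H2_cst 1) (closed_subspaceZ v^* closed_H2 Ht).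
Qed.

Lemma bounded_frostman_den v theta : unimodular theta ->
  bounded_by (1 + normc v) (den v theta).
Proof.
apply: ae_imp => t H It; rewrite /den.
by apply: le_trans (le_normcD _ _) _; rewrite normcN normcM normcJE (normc1E (H It)) mulr1 normc1.
Qed.

Lemma bounded_frostman_denV v theta : normc v < 1 -> unimodular theta ->
  bounded_by (1 - normc v)^-1 (fun t => (den v theta t)^-1).
Proof.
move=> v1; apply: ae_imp => t H It; have d := frostman_den_ge v1 (H It).
have p0 : 0 < 1 - normc v by rewrite subr_gt0.
by rewrite normcV lef_pV2// posrE// (lt_le_trans p0).
Qed.

Lemma H2M_den v theta f : inner_function theta -> H2 f -> H2 (fun t => den v theta t * f t).
Proof.
move=> it; apply: H2M; last exact/H2_frostman_den/inner_H2.
exact/bounded_frostman_den/inner_unimodular.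
Qed.

Lemma frostman_denVK v theta f : normc v < 1 -> unimodular theta ->
  aeq (fun t => den v theta t * ((den v theta t)^-1 * f t)) f.
Proof.
move=> v1; apply: ae_imp => t H It.
by rewrite mulrA divff ?mul1r//; exact: frostman_den_neq0 (H It).
Qed.

(* Let [q] be the component of [1/(1 - v^* theta)] orthogonal to [H2]; then
   [q - v^* theta q] lies in [H2], so [|q|^2 = v <q, theta q>] and [q = 0]. *)
Lemma H2_frostman_denV v theta : normc v < 1 -> inner_function theta ->
  H2 (fun t => (den v theta t)^-1).
Proof.
move=> v1 it; have ut := inner_unimodular it; have Ht := inner_H2 it.
set u := (fun t => _).
have Lu : L2 u.
  have mw : cmeas u by apply/cmeasV/L2_cmeas/H2_L2/H2_frostman_den.
  have := L2M_bdd mw (bounded_frostman_denV v1 ut) (L2_cst 1); congr L2.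
  by apply/funext => t; rewrite mulr1.
have [p Hp uo] := orthogonal_projection closed_H2 Lu.
have Lp := H2_L2 Hp.
pose q t := u t - p t; have Lq : L2 q by exact: L2B.
have Lwq : L2 (fun t => den v theta t * q t).
  apply: L2M_bdd (bounded_frostman_den v ut) Lq.
  exact/L2_cmeas/H2_L2/H2_frostman_den.
have Hwq : H2 (fun t => den v theta t * q t).
  have H1 := closed_subspaceB closed_H2 (H2_cst 1) (H2M_den v it Hp).
  apply: closed_subspace_aeq closed_H2 H1 Lwq _; move: ut; apply: ae_imp => t ut It.
  rewrite /q mulrBr /u mulfV//; exact: frostman_den_neq0 (ut It).
have Ltq := inner_L2M it Lq.
have := uo _ Hwq; rewrite -/q.
have -> : (fun t => den v theta t * q t) = (fun t => q t - v^* * (theta t * q t)).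
  by apply/funext => t; rewrite /den; ring.
rewrite ipBr ?ipZr//; last exact: L2Z.
rewrite conjcKE => /eqP; rewrite subr_eq0 => /eqP e.
have := cauchy_schwarz Lq Ltq.
have -> : norm2 (fun t => theta t * q t) = norm2 q.
  apply: norm2_aeq => //; move: ut; apply: ae_imp => t ut It.
  by rewrite normcM (normc1E (ut It)) mul1r.
move=> CS; have := congr1 (@normc R) e.
have -> : normc (inner_prod q q) = norm2 q ^+ 2.
  by rewrite ip_norm2 /= expr0n/= addr0 sqrtr_sqr ger0_norm// sqr_ge0.
rewrite normcM => e2.
have q0 : norm2 q ^+ 2 <= 0.
  have : 0 <= norm2 q ^+ 2 by exact: sqr_ge0.
  have := normc_ge0 v; have := normc_ge0 (inner_prod q (fun t => theta t * q t)); move: CS.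
  rewrite -expr2; move: e2; set A := norm2 q ^+ 2; set B := normc (inner_prod _ _).
  nra.
have /(norm2_eq0 Lq) /aeqB0 up : norm2 q = 0.
  by apply/eqP; rewrite -sqrf_eq0 eq_le q0 sqr_ge0.
exact: closed_subspace_aeq closed_H2 Hp Lu (aeq_sym up).
Qed.

Lemma H2M_denV v theta f : normc v < 1 -> inner_function theta -> H2 f ->
  H2 (fun t => (den v theta t)^-1 * f t).
Proof.
move=> v1 it; apply: H2M; last exact: H2_frostman_denV.
exact: bounded_frostman_denV v1 (inner_unimodular it).
Qed.

Lemma frostman_inner v theta : normc v < 1 -> inner_function theta ->
  inner_function (frostman v theta).
Proof.
move=> v1 it; have ut := inner_unimodular it; apply: unimodular_inner.
  have := H2M_denV v1 it (closed_subspaceB closed_H2 (inner_H2 it) (H2_cst v)).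
  by congr H2; apply/funext => t; rewrite mulrC.
move: ut; apply: ae_imp => t ut It; have d0 := frostman_den_neq0 v1 (ut It).
have d0' : (1 - v^* * theta t)^* != 0 by rewrite conjc_eq0.
(* Where [|theta| = 1], both sides equal [1 + |v|^2 - 2 Re(conj(v) theta)]. *)
have e : (theta t - v) * (theta t - v)^* = (1 - v^* * theta t) * (1 - v^* * theta t)^*.
  rewrite !(conjcD, conjcN, conjcM) conjcKE conjc1E.
  have := ut It; set x := theta t => ux.
  have -> : (x - v) * (x^* - v^*) = x * x^* - x * v^* - v * x^* + v * v^* by ring.
  have -> : (1 - v^* * x) * (1 - v * x^*) = 1 - x * v^* - v * x^* + v * v^* * (x * x^*) by ring.
  by rewrite ux mulr1.
rewrite /frostman conjcM.
have -> : ((1 - v^* * theta t)^-1)^* = ((1 - v^* * theta t)^*)^-1 by exact: conjc_inv.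
by rewrite mulrACA e -invfM divff// mulf_neq0.
Qed.

(** Where [|theta| = 1], [conj(theta - v) = conj(theta) (1 - v^* theta)], which cancels the
    denominator under [f]. Orthogonality of [f / den] to [theta_v H2] thus reduces to that of [f] to
    [theta H2]. *)
Lemma ip_frostman v theta f y : normc v < 1 -> inner_function theta ->
  H2 f -> H2 y ->
  inner_prod (fun t => (den v theta t)^-1 * f t) (fun t => frostman v theta t * y t) =
  inner_prod f (fun t => theta t * ((den v theta t)^-1 * y t)).
Proof.
move=> v1 it Hf Hy; apply: cint_aeq.
- apply: cintegrable_cmeas; apply: ip_cintegrable; first exact/H2_L2/H2M_denV.
  exact/H2_L2/inner_H2M/Hy/frostman_inner.
- apply: cintegrable_cmeas; apply: ip_cintegrable; first exact: H2_L2.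
  exact/H2_L2/inner_H2M/H2M_denV.
move: (inner_unimodular it); apply: ae_imp => t ut It.
have d0 := frostman_den_neq0 v1 (ut It).
have d0' : (1 - v^* * theta t)^* != 0 by rewrite conjc_eq0.
have iJ : ((1 - v^* * theta t)^-1)^* = ((1 - v^* * theta t)^*)^-1 by exact: conjc_inv.
rewrite /frostman /den !conjcM iJ; set d := 1 - _ in d0 d0' iJ *.
have e : (theta t - v)^* = (theta t)^* * d.
  rewrite /d conjcD conjcN mulrBr mulr1 mulrCA [_^* * theta t]mulrC (ut It) mulr1//.
rewrite e; field.
by rewrite d0 d0'.
Qed.

Lemma model_space_frostman v theta f : normc v < 1 -> inner_function theta ->
  model_space theta f -> model_space (frostman v theta) (fun t => (den v theta t)^-1 * f t).
Proof.
move=> v1 it /(model_spaceP _ it)[Hf fo]; apply/model_spaceP; first exact: frostman_inner.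
split; first exact: H2M_denV.
by move=> y Hy; rewrite ip_frostman// fo//; exact: H2M_denV.
Qed.

(** Makes [J_v^{-1}] a scalar multiple of multiplication by [1 - v^* theta]. It is [crofootK] read
    at the right-hand side, whose Crofoot transform is [f]. *)
Lemma crofoot_inv_aeq v theta f : normc v < 1 -> inner_function theta ->
  aeq (crofoot_inv v theta f)
    (fun t => ((Num.sqrt (1 - normc v ^+ 2))^-1)%:C * (den v theta t * f t)).
Proof.
move=> v1 it; move: (inner_unimodular it); apply: ae_imp => t ut It.
have d0 := frostman_den_neq0 v1 (ut It).
have v2 : 0 < 1 - normc v ^+ 2.
  by rewrite subr_gt0 expr_lt1// normc_ge0.
set s := Num.sqrt _ : R; have s0 : s != 0 by rewrite gt_eqF// sqrtr_gt0.
have := @crofootK R v theta (fun x => (s^-1)%:C * (den v theta x * f x)) t v1 d0.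
rewrite -[RHS]/((s^-1)%:C * (den v theta t * f t)) => <-.
rewrite /crofoot_inv /crofoot; congr (_ * _).
rewrite -/s -/(den v theta t).
have e : s%:C * (s^-1)%:C = 1 by rewrite -rmorphM/= divff.
have -> : s%:C / den v theta t * ((s^-1)%:C * (den v theta t * f t)) =
  (s%:C * (s^-1)%:C) * ((den v theta t)^-1 * (den v theta t * f t)) by ring.
by rewrite e mul1r mulKf.
Qed.

End Frostman.

(** * Invariant subspaces *)

Section InvariantSubspaces.
Variable R : realType.
Local Notation mu := (@lebesgue_measure R).
Local Notation I01 := (`[0, 1]%classic : set R).
Local Notation zX n := (fun t : R => zeta t ^ n).
Implicit Types (f g k theta b phi : R -> R[i]) (a z v c : R[i]) (N L M : set (R -> R[i])).

(* The hypothesis on [N] is its invariance under the compressed shift of [K_b]. Beurling's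
   theorem is applied to [N (+) b H2], obtained as the orthocomplement in [H2] of [K_b (-) N]. *)
Theorem model_space_invariant b N : inner_function b -> closed_subspace N ->
  N `<=` model_space b ->
  (forall f, N f -> exists g c, N g /\ aeq (mul_zeta f) (fun t => g t + b t * c)) ->
  exists phi, [/\ inner_function phi, inner_divides phi b &
    ominus (model_space b) (model_space phi) = N].
Proof.
move=> ib cN NK Nz; have cK := closed_model_space b; have Hb := inner_H2 ib.
have ub := inner_unimodular ib; have LN := closed_subspace_L2 cN.
have KP f : model_space b f -> forall y, H2 y -> inner_prod f (fun t => b t * y t) = 0.
  by move=> /(model_spaceP _ ib)[].
have KH f : model_space b f -> H2 f by case.
pose X := ominus (model_space b) N.
have XL : X `<=` @L2 R by move=> f [/KH/H2_L2].
pose L := (@H2 R) `&` orthogonal_of X.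
have cL : closed_subspace L by apply: closed_setI; [exact: closed_H2|exact: closed_orthogonal_of].
have LL := closed_subspace_L2 cL.
have NL : N `<=` L.
  move=> f Nf; have Hf := KH _ (NK _ Nf); split => //; split; first exact: H2_L2.
  move=> k Xk; have [_ ko] := Xk.
  by rewrite (ipC (XL _ Xk) (LN _ Nf)) ko// conjc0E.
have bL y : H2 y -> L (fun t => b t * y t).
  move=> Hy; have Hby := inner_H2M ib Hy; split => //; split; first exact: H2_L2.
  move=> k Xk; have [Kk _] := Xk.
  by rewrite (ipC (XL _ Xk) (H2_L2 Hby)) KP// conjc0E.
(* [L = N + b H2] is obtained by projecting first on [N], then on [B], which is [b H2]. The
   remainder [d] lies in [K_b] and is orthogonal to [N], so it is in [X]; being also in [L], it is
   orthogonal to itself. *)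
have Ldec f : L f -> exists g y, [/\ N g, H2 y & aeq f (fun t => g t + b t * y t)].
  move=> Lf; have [n Nn fn] := orthogonal_projection cN (LL _ Lf).
  pose r t := f t - n t.
  have Lr : L r by apply: closed_subspaceB => //; exact: NL.
  pose B := [set g : R -> R[i] | L2 g /\ H2 (fun t => (b t)^* * g t)].
  have cB : closed_subspace B.
    apply: (@closed_preimage_mul _ _ (fun t => (b t)^*) 1) => //; first exact: closed_H2.
      exact/cmeasJ/L2_cmeas/H2_L2.
    exact/unimodular_bounded/unimodularJ.
  have [p Bp rp] := orthogonal_projection cB (LL _ Lr).
  have [Lp Hbp] := Bp; pose y t := (b t)^* * p t.
  have pE : aeq p (fun t => b t * y t) by apply: aeq_sym; exact: unimodularMJK.
  have LLp : L p by apply: closed_subspace_aeq cL (bL _ Hbp) Lp (aeq_sym pE).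
  pose d t := r t - p t.
  have Ld : L d by exact: closed_subspaceB.
  have LLd := LL _ Ld.
  have Kd : model_space b d.
    apply/model_spaceP => //; split; first by case: Ld.
    move=> x Hx; apply: rp; split; first exact/H2_L2/inner_H2M.
    apply: (closed_subspace_aeq closed_H2 Hx); last by apply: aeq_sym; exact: unimodularJMK.
    by apply: inner_L2JM => //; exact/H2_L2/inner_H2M.
  have Xd : X d.
    split => // g Ng; have Lg := LN _ Ng.
    have Lby := H2_L2 (inner_H2M ib Hbp).
    have LLr := LL _ Lr; rewrite ipBl//.
    rewrite fn// (ip_aeql Lp Lby Lg pE) (ipC Lg Lby) (KP _ (NK _ Ng) _ Hbp).
    by rewrite conjc0E subr0.
  have /(aeq_ip0 LLd) d0 : inner_prod d d = 0 by have [_ [_]] := Ld; exact.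
  exists n, y; split => //.
  move: d0 pE; apply: ae_imp2 => t d0 pE It; rewrite -pE//.
  by have := d0 It; rewrite /d /r => /eqP; rewrite subr_eq0 => /eqP <-; rewrite addrC subrK.
have Lz f : L f -> L (mul_zeta f).
  move=> Lf; have [g [y [Ng Hy fE]]] := Ldec _ Lf.
  have [g1 [c [Ng1 gE]]] := Nz _ Ng.
  have L1 := closed_subspaceD cL (closed_subspaceD cL (NL _ Ng1) (bL _ (H2_cst c)))
    (bL _ (H2_mul_zeta Hy)).
  apply: (closed_subspace_aeq cL L1); first by rewrite mul_zetaE; exact/L2_zetaXM/LL.
  move: fE gE; apply: ae_imp2 => t fE gE It; rewrite -gE// /mul_zeta fE//; ring.
have Lb : L b by have := bL _ (H2_cst 1); congr L; apply/funext => t; rewrite mulr1.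
have b0 : ~ aeq b (fun=> 0).
  move=> be; have := ip_inner ib (L2_cst (1 : R[i])) (L2_cst (1 : R[i])).
  have -> : (fun t => b t * 1) = b by apply/funext => t; rewrite mulr1.
  rewrite (ip_aeql (H2_L2 Hb) (L2_cst 0) (H2_L2 Hb) be) ip0l -cint_ip1 cint_cst.
  by move=> /eqP; rewrite eq_sym oner_eq0.
have LH : L `<=` @H2 R by move=> f [].
have [phi [iphi Lphi LE]] := beurling cL LH Lz Lb b0.
have uphi := inner_unimodular iphi.
exists phi; split => //.
  (* Divisibility comes from [b] lying in [L = phi H2]: the cofactor [y] is [b / phi]. *)
  have [_ [y Hy bE]] : mul_set phi (@H2 R) b by rewrite -LE.
  have qE : aeq y (fun t => b t / phi t).
    move: uphi bE; apply: ae_imp2 => t up bE It; rewrite bE//= mulrAC divff ?mul1r//.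
    by apply/eqP => e; have /eqP := up It; rewrite e mul0r eq_sym oner_eq0.
  have mq : cmeas (fun t => b t / phi t).
    by apply: cmeasM; [|apply: cmeasV]; exact/L2_cmeas/H2_L2/inner_H2.
  apply: unimodular_inner.
    exact: closed_subspace_aeq closed_H2 Hy (L2_aeq mq qE (H2_L2 Hy)) qE.
  move: ub uphi; apply: ae_imp2 => t ubt upt It; rewrite conjcM.
  have -> : ((phi t)^-1)^* = ((phi t)^*)^-1 by exact: conjc_inv.
  by rewrite mulrACA ubt// -invfM upt// invr1 mulr1.
apply/seteqP; split => f.
  move=> [Kf fo]; have Hf := KH _ Kf; have Lf := H2_L2 Hf.
  (* [X] is orthogonal to [L = phi H2], hence contained in [K_phi]; so [f] is orthogonal to [X]. In
     the decomposition [f = g + b y] the difference [f - g] is then both in [K_b] and in [b H2],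
     hence zero. *)
  have LLf : L f.
    split => //; split => // k Xk; apply: fo; have [Kk _] := Xk.
    split; first exact: KH.
    move=> g; rewrite -LE => Lg; rewrite (ipC (LL _ Lg) (XL _ Xk)).
    by have [_ [_ Hg]] := Lg; rewrite Hg ?conjc0E.
  have [g [y [Ng Hy fE]]] := Ldec _ LLf.
  have Lg := LN _ Ng; apply: (closed_subspace_aeq cN Ng Lf); apply/aeq_sym/aeqB0.
  have Kd : model_space b (fun t => f t - g t) by apply: closed_subspaceB => //; exact: NK.
  have Ld := H2_L2 (KH _ Kd).
  apply: aeq_ip0 => //; rewrite -[RHS](KP _ Kd _ Hy).
  apply: ip_aeqr => //; first exact/H2_L2/inner_H2M.
  by move: fE; apply: ae_imp => t fE It; rewrite fE// addrC addrA addNr add0r.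
move=> Nf; split; first exact: NK.
move=> k [Hk ko]; have := NL _ Nf; rewrite LE => /ko kf.
by rewrite (ipC (H2_L2 Hk) (LN _ Nf)) kf conjc0E.
Qed.

Lemma hitt_restrict M h theta N : hitt M h theta -> closed_subspace N ->
  closed_subspace [set f | model_space theta f /\ N (fun t => h t * f t)].
Proof.
move=> H cN; have cK := closed_model_space theta; split.
- by move=> f [/(closed_subspace_L2 cK)].
- split; first exact: closed_subspace0.
  have := closed_subspace0 cN; congr N; apply/funext => t; by rewrite mulr0.
- move=> a f g [Kf Nf] [Kg Ng]; split; first exact: closed_subspace_lin.
  have := closed_subspace_lin cN a Nf Ng; congr N; apply/funext => t; ring.
- move=> u f Ku Lf cv.
  have Kf : model_space theta f.
    by apply: (closed_subspace_lim cK) cv => // n; have [] := Ku n.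
  split => //; apply: (closed_subspace_lim cN (u := fun n t => h t * u n t)).
  + by move=> n; have [] := Ku n.
  + by apply: (closed_subspace_L2 (hitt_closed H)); exact: hitt_mul Kf.
  rewrite (_ : (fun n => norm2 _) = (fun n => norm2 (u n \- f)))//; apply/funext => n.
  have Kd : model_space theta (fun t => u n t - f t).
    by apply: closed_subspaceB => //; have [] := Ku n.
  have [_ <-] := hitt_isometry H Kd; congr norm2; apply/funext => t /=; ring.
Qed.

End InvariantSubspaces.

Theorem theorem4p5 (R : realType) (M : set (R -> R[i])) (h theta : R -> R[i])
    (v : R[i]) (N : set (R -> R[i])) :
  hitt M h theta ->
  v = cint (fun t => theta t * `|h t| ^+ 2) ->
  closed_subspace N -> N `<=` M ->
  (forall f, N f -> N (compressed_shift M f)) ->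
  exists phi : R -> R[i],
    [/\ inner_function phi,
        inner_divides phi (frostman v theta) &
        N = mul_set h (crofoot_inv v theta @`
              ominus (model_space (frostman v theta)) (model_space phi))].
Proof.
move=> H vE cN NM NA.
have it := hitt_inner H; have ut := inner_unimodular it; have Ht := inner_H2 it.
have v1 := hitt_v_lt1 H vE; have ib := frostman_inner v1 it.
have cM := hitt_closed H; have LM := closed_subspace_L2 cM.
have cK := closed_model_space theta.
have LK f : model_space theta f -> L2 f by exact: closed_subspace_L2.
pose den := frostman_den v theta.
(* [N0] is [N] with the factor [h] removed and [N'] is [N0] divided by [den]. Scalars do not change
   a subspace, so [N'] is the preimage of [N] under [h J_v^{-1}]. *)
pose N0 := [set f | model_space theta f /\ N (fun t => h t * f t)].
have cN0 : closed_subspace N0 by exact: hitt_restrict H cN.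
pose N' := [set f : R -> R[i] | L2 f /\ N0 (fun t => den t * f t)].
have cN' : closed_subspace N'.
  apply: (@closed_preimage_mul _ _ den (1 + normc v)) => //.
  - exact/L2_cmeas/H2_L2/H2_frostman_den.
  - by rewrite addr_ge0 ?ler01 ?normc_ge0.
  - exact: bounded_frostman_den.
have denK f : aeq (fun t => (den t)^-1 * (den t * f t)) f.
  move: ut; apply: ae_imp => t ut It; rewrite mulKf//.
  exact: frostman_den_neq0 (ut It).
have N'K : N' `<=` model_space (frostman v theta).
  move=> f [Lf [Kf _]].
  by apply: closed_subspace_aeq (closed_model_space _) (model_space_frostman v1 it Kf) Lf (denK f).
have N0N' f : N0 f -> N' (fun t => (den t)^-1 * f t).
  move=> N0f; have [Kf _] := N0f.
  have Hf : H2 f by case: Kf.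
  have Hd := H2M_denV v1 it Hf.
  split; first exact: H2_L2.
  apply: closed_subspace_aeq cN0 N0f _ (aeq_sym (frostman_denVK f v1 ut)).
  exact/H2_L2/H2M_den.
have [f Nf|phi [iphi phib DE]] := model_space_invariant ib cN' N'K.
  have [Lf [Kf Nhf]] := Nf.
  set f0 := (fun t => den t * f t) in Kf Nhf.
  have := compressed_shift_model H vE cN NM NA Nhf Kf (aeq_refl _).
  set c := inner_prod _ _ => Nh1.
  pose f1 t := mul_zeta f0 t - c * (theta t - v).
  have Kf1 : model_space theta f1.
    have := closed_subspaceD cK (model_space_shift it Kf)
      (closed_subspaceZ (c * v) cK (hitt_model_cst1 H)).
    by congr model_space; apply/funext => t; rewrite /f1 -/c; ring.
  have N0f1 : N0 f1 by split.
  (* Dividing [f1 = zeta den f - c (theta - v)] by [den] leaves [zeta f - c theta_v], so the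
     coefficient along [theta_v] is again [c]. *)
  exists (fun t => (den t)^-1 * f1 t), c; split; first exact: N0N'.
  move: ut; apply: ae_imp => t ut It.
  have d0 : den t != 0 by exact: frostman_den_neq0 (ut It).
  rewrite /f1 /f0 /mul_zeta /frostman -/(frostman_den v theta t) -/(den t).
  by field.
exists phi; split => //; rewrite DE.
pose s : R := Num.sqrt (1 - normc v ^+ 2).
have s0 : s != 0.
  by rewrite gt_eqF// sqrtr_gt0 subr_gt0 expr_lt1// normc_ge0.
have crE f : aeq (crofoot_inv v theta f) (fun t => (s^-1)%:C * (den t * f t)).
  exact: crofoot_inv_aeq.
apply/seteqP; split => f.
  move=> Nf; have Mf := NM _ Nf; have Lf := LM _ Mf; split => //.
  have [_ [g Kg fE]] : mul_set h (model_space theta) f by rewrite -(hitt_onto H).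
  (* The element sent to [g] by [J_v^{-1}] is [s g / den], whence the factor [s]. *)
  have N0g : N0 (fun t => s%:C * g t).
    split; first exact: closed_subspaceZ.
    apply: closed_subspace_aeq cN (closed_subspaceZ s%:C cN Nf) _ _.
      by apply: LM; apply: hitt_mul H _; exact: closed_subspaceZ.
    by move: fE; apply: ae_imp => t fE It; rewrite fE//=; ring.
  exists (crofoot_inv v theta (fun t => (den t)^-1 * (s%:C * g t))).
    by exists (fun t => (den t)^-1 * (s%:C * g t)); first exact: N0N'.
  have e3 : aeq (crofoot_inv v theta (fun t => (den t)^-1 * (s%:C * g t))) g.
    have e1 := frostman_denVK (fun t => s%:C * g t) v1 ut.
    move: (crE (fun t => (den t)^-1 * (s%:C * g t))) e1; apply: ae_imp2 => t e1 e2 It.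
    by rewrite e1// e2// mulrA -rmorphM/= mulVf// mul1r.
  by move: fE e3; apply: ae_imp2 => t fE e3 It; rewrite fE//= e3.
move=> [Lf [_ [g [Lg [Kg Ng]] <-] fE]].
apply: (closed_subspace_aeq cN (closed_subspaceZ (s^-1)%:C cN Ng)) => //.
move: fE (crE g); apply: ae_imp2 => t fE cE It; rewrite fE//= cE//; ring.
Qed.
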